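(* Let $\varphi:\mathbb{R}\to\mathbb{R}$ be $\lambda_\varphi$-Lipschitz and $\sigma:\mathbb{R}\to\mathbb{R}$ be $\lambda_\sigma$-Lipschitz. Let $A\in\mathbb{R}^{T\times T}$ be such that $\|A\|\le 1$ and, for $X\in\mathbb{R}^{p\times T}$ and $w=\varphi(\tilde w)\in\mathbb{R}^p$ with $\tilde w\sim\mathcal N(0,I_p)$, define the random vector $s\equiv\sigma(w^{\top}X)^{\top}\in\mathbb{R}^T$ and the matrix $\Phi=\mathbb{E}[ss^{\top}]\in\mathbb{R}^{T\times T}$. (i) Then, for all $t>0$, $$P\left(\left|\tfrac1T s^{\top}As-\tfrac1T\operatorname{tr}\Phi A\right|>t\right)\le C\exp\left(-\frac{cT}{\|X\|^2\lambda_\varphi^2\lambda_\sigma^2}\min\left(\frac{t^2}{t_0^2},t\right)\right)$$ for $t_0\equiv|\sigma(0)|+\lambda_\varphi\lambda_\sigma\|X\|\sqrt{p/T}$ and $C,c>0$ independent of all other parameters. (ii) In particular, under the additional growth rate assumption described in the context, for all $t>0$, $$P\left(\left|\tfrac1T s^{\top}As-\tfrac1T\operatorname{tr}\Phi A\right|>t\right)\le C e^{-cn\min(t,t^2)}$$ for some constants $C,c>0$ independent of $n$ and $t$.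
   Context: $\|\cdot\|$ is the Euclidean norm for vectors and the operator (spectral) norm for matrices. The functions $\varphi$ and $\sigma$ are applied entry-wise to vectors and matrices. All vectors are column vectors. The matrices $X$ and $A$ are deterministic. Growth rate assumption: as $n\to\infty$ (with $p$, $T$, $X$ depending on $n$), $$0<\liminf_n\min\{p/n,T/n\}\le\limsup_n\max\{p/n,T/n\}<\infty,\qquad\limsup_n\|X\|<\infty,$$ while $\lambda_\sigma,\lambda_\varphi>0$ are kept constant. The assumption also requires that a regularization parameter $\gamma>0$ and an output dimension $d$ be kept constant and that $\limsup_n\max_{ij}|Y_{ij}|<\infty$ for an output data matrix $Y\in\mathbb{R}^{d\times T}$; the objects $\gamma,d,Y$ do not enter the present statement.
   Formalization: In (i), C is absolute but c may depend on the ratio |φ(0)|/λ_φ; with c independent of φ(0) the claim fails (p=T=1, A=X=1, σ=id, φ(x)=M+x, M→∞). When X=0, T=0 or t_0=0 the bound is read as C. *)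

(* Defs.v *)
From HB Require Import structures.
From mathcomp Require Import all_boot all_order all_algebra.
From mathcomp Require Import all_classical all_reals all_analysis.

Set Implicit Arguments.
Unset Strict Implicit.
Unset Printing Implicit Defensive.

Import Order.TTheory GRing.Theory Num.Theory.
Import numFieldNormedType.Exports.

Local Open Scope classical_set_scope.
Local Open Scope ring_scope.

(* The canonical norm of the library on matrices is the entrywise maximum, so
   the Euclidean norm and the operator norm it induces are defined here. *)
Definition enorm (R : realType) (n : nat) (u : 'cV[R]_n) : R :=
  Num.sqrt (\sum_(i < n) u i 0 ^+ 2).

Definition opnorm (R : realType) (m n : nat) (A : 'M[R]_(m, n)) : R :=
  sup [set enorm (A *m u) | u in [set u : 'cV[R]_n | enorm u <= 1]].

(* For a finite family, the product rule over all measurable sets is mutual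
   independence: taking some [B i] to be [setT] gives every subfamily. *)
Definition mutually_independent d (Omega : measurableType d) (R : realType)
    (P : probability Omega R) (p : nat) (W : 'I_p -> {RV P >-> R}) : Prop :=
  forall B : 'I_p -> set R, (forall i, measurable (B i)) ->
    P (\bigcap_i (W i @^-1` B i)) = (\prod_(i < p) P (W i @^-1` B i))%E.

(* [W] is distributed as N(0, I_p). *)
Definition standard_gaussian d (Omega : measurableType d) (R : realType)
    (P : probability Omega R) (p : nat) (W : 'I_p -> {RV P >-> R}) : Prop :=
  mutually_independent W /\
  (forall (i : 'I_p) (B : set R), measurable B ->
     distribution P (W i) B = normal_prob 0 1 B).

Definition random_col d (Omega : measurableType d) (R : realType)
    (P : probability Omega R) (p : nat) (W : 'I_p -> {RV P >-> R})
    (x : Omega) : 'cV[R]_p :=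
  \col_(i < p) W i x.

(* s = sigma (w^T X)^T with w = phi (w~), as a function of w~. *)
Definition feature (R : realType) (p T : nat) (phi sigma : R -> R)
    (X : 'M[R]_(p, T)) (u : 'cV[R]_p) : 'cV[R]_T :=
  (map_mx sigma ((map_mx phi u)^T *m X))^T.

(* E[s s^T]; [fine] loses nothing when the entries are integrable, as they are
   for a Lipschitz image of a Gaussian vector. *)
Definition second_moment d (Omega : measurableType d) (R : realType)
    (P : probability Omega R) (T : nat) (s : Omega -> 'cV[R]_T) : 'M[R]_T :=
  \matrix_(i < T, j < T) fine ('E_P[fun x => (s x *m (s x)^T) i j])%E.

(* The event | s^T A s / T - tr (Phi A) / T | > t with Phi = E[s s^T]. *)
Definition deviation_event d (Omega : measurableType d) (R : realType)
    (P : probability Omega R) (T : nat) (A : 'M[R]_T)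
    (s : Omega -> 'cV[R]_T) (t : R) : set Omega :=
  [set x | `| T%:R^-1 * ((s x)^T *m A *m s x) 0 0
              - T%:R^-1 * \tr (second_moment P s *m A) | > t].

Definition growth_rate (R : realType) (p T : nat -> nat)
    (X : forall n, 'M[R]_(p n, T n)) : Prop :=
  [/\ (0 < limn_einf (fun n =>
             (Num.min ((p n)%:R / n%:R : R) ((T n)%:R / n%:R))%:E))%E,
      (limn_einf (fun n =>
             (Num.min ((p n)%:R / n%:R : R) ((T n)%:R / n%:R))%:E)
       <= limn_esup (fun n =>
             (Num.max ((p n)%:R / n%:R : R) ((T n)%:R / n%:R))%:E))%E,
      (limn_esup (fun n =>
             (Num.max ((p n)%:R / n%:R : R) ((T n)%:R / n%:R))%:E) < +oo)%E &
      (limn_esup (fun n => (opnorm (X n))%:E) < +oo)%E].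

(* Main.v *)
Require Import Defs.
From HB Require Import structures.
From mathcomp Require Import all_boot all_order all_algebra.
From mathcomp Require Import all_classical all_reals all_analysis.
From mathcomp Require Import measurable_realfun.
From mathcomp Require Import ring lra.

(** Let s(u) = sigma(X^T phi(u)), which is L-Lipschitz with
    L = lphi lsigma |X|, and let F(u) = s(u)^T A s(u), m = E F(W). The function
    F is not Lipschitz, but with |A| <= 1
      F(u) - F(v) <= 2 |s(u)| L |u - v| + L^2 |u - v|^2,
    so that the size of s(u) governs the oscillation of F around u.

    The Gaussian ingredient is Maurey's property (tau): if
    f(u) g(v) <= exp(|u - v|^2 / 4) for all u and v, then E f(W) E g(W) <= 1.
    It involves no gradient, which suits functions that are merely Lipschitz.
    On the line it is the Prekopa-Leindler inequality
    ([prekopa_leindler_line], [property_tau_gaussian]), a consequence of the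
    Brunn-Minkowski inequality |A + B| >= |A| + |B|; it passes to products by
    Fubini's theorem ([property_tau_prod]), hence to every dimension with the
    same constant.

    Apply it to f = exp(l (F - m) - 8 l^2 L^2 |s|^2) and g = exp(-l (F - m)),
    where l > 0 and 8 l L^2 <= 1. The inequality between f(u) and g(v) is the
    arithmetic-geometric inequality, and E g(W) >= 1 because exp y >= 1 + y.
    Hence E f(W) <= 1 ([penalized_exp_moment]). On the event F - m > h either f
    is at least exp(l h / 2), or |s|^2 is of order h / (l L^2). Since
    |s(u)| <= b + L (|u| - 2 sqrt p) for a b of order t0 sqrt T, the second case
    forces |W| >= 2 sqrt p + r with r = sqrt h / L once l is a small multiple of
    min(h / b^2, 1) / L^2, and this has probability at most exp(-r^2 / 4) because
    E exp(|W|^2 / 4) = 2^(p/2). The two bounds together give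
    [quadratic_growth_tail]; applied to A and to -A with h = T t they give
    [feature_deviation]. The value phi(0) enters b through
    |phi(u)| <= lphi (|u| + sqrt p |phi(0)| / lphi), which is why the rate
    depends on the ratio |phi(0)| / lphi.

    For the second part, the growth assumption bounds n / T, p / T and |X| for
    all large n, hence, the remaining indices being finite in number, for all n
    ([growth_rate_bounds]); the indices with T = 0 are set apart, the event being
    empty for them. *)

Set Implicit Arguments.
Unset Strict Implicit.
Unset Printing Implicit Defensive.

Import Order.TTheory GRing.Theory Num.Theory.
Import numFieldNormedType.Exports.

Local Open Scope classical_set_scope.
Local Open Scope ring_scope.

(** * Superlevel sets and layer-cake formula *)

Section superlevel_sets.
Context d (T : measurableType d) (R : realType).

Lemma measurable_ge_set (f : T -> R) (a : R) :
  measurable_fun setT f -> measurable [set x | a <= f x].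
Proof.
move=> mf; rewrite (_ : [set x | _] = (fun x => a <= f x) @^-1` [set true])//.
by rewrite -[_ @^-1` _]setTI; apply: measurable_fun_ler.
Qed.

Lemma measurable_gt_set (f : T -> R) (a : R) :
  measurable_fun setT f -> measurable [set x | a < f x].
Proof.
move=> mf; rewrite (_ : [set x | _] = (fun x => a < f x) @^-1` [set true])//.
by rewrite -[_ @^-1` _]setTI; apply: measurable_fun_ltr.
Qed.

End superlevel_sets.

Section layer_cake.
Local Open Scope ereal_scope.
Context d (T : measurableType d) (R : realType)
  (m : {sigma_finite_measure set T -> \bar R}).
Local Notation mu := (@lebesgue_measure R).
Variable f : T -> R.
Hypothesis mf : measurable_fun setT f.

(* The formula is Fubini's theorem for the region below the graph of f. *)
Let hypograph := [set p : T * measurableTypeR R | (0 <= p.2 < f p.1)%R].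

Let measurable_hypograph : measurable hypograph.
Proof.
have mf1 : measurable_fun setT (fun p : T * measurableTypeR R => f p.1).
  exact: measurableT_comp.
have m2 : measurable_fun setT (fun p : T * measurableTypeR R => p.2 : R).
  exact: measurable_snd.
have -> : hypograph = (fun p => (0 <= p.2)%R && (p.2 < f p.1)%R) @^-1` [set true].
  by apply/seteqP; split => p /=.
rewrite -[_ @^-1` _]setTI; apply: measurable_and => //.
- exact: measurable_fun_ler.
- exact: measurable_fun_ltr.
Qed.

Let indic_hypograph_measurable :
  measurable_fun setT (fun p : T * measurableTypeR R => (\1_hypograph p : R)%:E).
Proof. exact/measurable_EFinP/measurable_indic. Qed.

Let tailE t : m [set x | (0 <= t < f x)%R] =
  \int[m]_x (\1_hypograph (x, t) : R)%:E.
Proof.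
under eq_integral => x _.
  rewrite (_ : \1_hypograph (x, t) = \1_([set x | (0 <= t < f x)%R]) x :> R)//.
  over.
rewrite integral_indic// ?setIT//.
have := @measurable_ysection _ _ _ _ hypograph t measurable_hypograph.
congr measurable; apply/seteqP; split => x /=.
  by rewrite /ysection/= inE.
by rewrite /ysection/= inE.
Qed.

Lemma measurable_tail : measurable_fun (setT : set (measurableTypeR R))
  (fun t => m [set x | (0 <= t < f x)%R]).
Proof.
under eq_fun do rewrite tailE.
apply: (@measurable_fun_fubini_tonelli_G _ _ _ _ _ _
  (fun p : T * measurableTypeR R => (\1_hypograph p : R)%:E)) => //.
Qed.

Lemma layer_cake : (forall x, 0 <= f x)%R ->
  \int[m]_x (f x)%:E = \int[mu]_t m [set x | (0 <= t < f x)%R].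
Proof.
move=> f0.
under [RHS]eq_integral do rewrite tailE.
rewrite -(@fubini_tonelli _ _ _ (measurableTypeR R) R m mu
  (fun p => (\1_hypograph p : R)%:E))//.
apply: eq_integral => x _.
under eq_integral => t _.
  rewrite (_ : \1_hypograph (x, t) = \1_(`[0%R, f x[%classic) t :> R); last first.
    by rewrite !indicE; congr ((_ : bool)%:R); apply/idP/idP; rewrite !inE/= in_itv.
  over.
rewrite integral_indic// setIT [RHS](lebesgue_measure_itv `[0%R, f x[)/= lte_fin.
case: ltP => [_|fx0]; first by rewrite sube0.
by congr EFin; apply/le_anti; rewrite f0 fx0.
Qed.

End layer_cake.

(** * Brunn-Minkowski and Prekopa-Leindler inequalities on the line *)

Section line.
Context {R : realType}.
Local Notation mu := (@lebesgue_measure R).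

Let translateE (a : R) (A : set R) :
  [set a + x | x in A] = (fun x => x - a) @^-1` A.
Proof.
apply/seteqP; split=> [_ [x Ax <-]|x Ax] /=; first by rewrite addrAC subrr add0r.
by exists (x - a) => //; rewrite addrC subrK.
Qed.

Let measurable_subr (a : R) :
  measurable_fun setT (fun x : measurableTypeR R => x - a : measurableTypeR R).
Proof. exact: measurable_funD. Qed.

Lemma measurable_translate (a : R) (A : set R) : measurable A ->
  measurable [set a + x | x in A].
Proof.
by move=> mA; rewrite translateE -[_ @^-1` _]setTI; exact: measurable_subr.
Qed.

Lemma lebesgue_translate (a : R) (A : set R) : measurable A ->
  mu [set a + x | x in A] = mu A.
Proof.
move=> mA; rewrite translateE.
pose pushed := pushforward mu (fun x : measurableTypeR R => x - a
  : measurableTypeR R) : {measure set (measurableTypeR R) -> \bar R}.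
pose nu := pushed (measurable_subr a).
suff /(_ _ mA) -> : forall A, measurable A -> mu A = nu A by [].
apply: lebesgue_measure_unique => _ [[b c] _ <-].
have -> : nu `]b, c]%classic = mu `]b + a, c + a]%classic.
  rewrite /nu /= /pushforward; congr (mu _).
  by apply/seteqP; split => x /=; rewrite !in_itv/= ltrBrDr lerBlDr.
rewrite !lebesgue_measure_itv/= !lte_fin ltrD2r -!EFinD.
by rewrite [c + a]addrC [b + a]addrC opprD addrACA subrr add0r.
Qed.

(** If a is near the supremum of A and b near the infimum of B, then the
    translates A + b and a + B lie in A + B and overlap only in a short
    interval around a + b. The sum set itself need not be measurable, hence the
    measurable C containing it. *)
Lemma brunn_minkowski_line (A B C : set R) (r : R) :
  measurable A -> measurable B -> measurable C ->
  A !=set0 -> B !=set0 -> A `<=` `[- r, r] -> B `<=` `[- r, r] ->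
  (forall a b, A a -> B b -> C (a + b)) ->
  (mu A + mu B <= mu C)%E.
Proof.
move=> mA mB mC A0 B0 Ar Br ABC.
have fin D : measurable D -> D `<=` `[- r, r] -> (mu D < +oo)%E.
  move=> mD Dr; apply: (@le_lt_trans _ _ (mu `[- r, r]%classic)).
    by apply: le_measure; rewrite ?inE.
  by rewrite lebesgue_measure_itv/=; case: ifP => _; rewrite ltry.
have sA : has_sup A.
  by split => //; exists r => x /Ar /=; rewrite in_itv/= => /andP[].
have iB : has_inf B.
  by split => //; exists (- r) => x /Br /=; rewrite in_itv/= => /andP[].
apply/lee_addgt0Pr => e e0; pose e2 := e / 2.
have e20 : 0 < e2 by rewrite divr_gt0.
have [a Aa ltsa] := sup_adherent e20 sA.
have [b Bb ltbi] := inf_adherent e20 iB.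
pose A' := [set b + x | x in A]; pose B' := [set a + x | x in B].
have mA' : measurable A' by exact: measurable_translate.
have mB' : measurable B' by exact: measurable_translate.
rewrite -(lebesgue_translate b mA) -(lebesgue_translate a mB) -/A' -/B'.
have A'fin : (mu A' < +oo)%E by rewrite lebesgue_translate// fin.
have B'fin : (mu B' < +oo)%E by rewrite lebesgue_translate// fin.
have I_le : (mu (A' `&` B') <= e%:E)%E.
  apply: (@le_trans _ _ (mu `[a + b - e2, a + b + e2]%classic)).
    apply: le_measure; rewrite ?inE//; first exact: measurableI.
    move=> _ [[x Ax <-] [y By yx]] /=; rewrite in_itv/=.
    have xs : x <= sup A by apply: ub_le_sup => //; case: sA.
    have iy : inf B <= y by apply: ge_inf => //; case: iB.
    by apply/andP; split; lra.
  rewrite lebesgue_measure_itv/= lte_fin; case: ifP => _; last by rewrite lee_fin ltW.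
  by rewrite -EFinB lee_fin /e2; lra.
have U_le : (mu (A' `|` B') <= mu C)%E.
  apply: le_measure; rewrite ?inE//; first exact: measurableU.
  by move=> _ [[x Ax <-]|[x Bx <-]]; [rewrite addrC|]; exact: ABC.
rewrite measureUfinr// in U_le.
have Ifin : mu (A' `&` B') \is a fin_num.
  by rewrite ge0_fin_numE//; apply: le_lt_trans I_le _; rewrite ltry.
rewrite leeBlDr// in U_le.
by apply: (le_trans U_le); rewrite leeD2l.
Qed.
End line.

Section prekopa_leindler.
Context {R : realType}.
Local Notation mu := (@lebesgue_measure R).

(** When f and g both have supremum 1, the superlevel sets of f and g at every
    height t in [0, 1[ are nonempty and their sum lies in that of h, so the
    Brunn-Minkowski inequality can be integrated over t. *)
Lemma prekopa_leindler_sup1 (f g h : R -> R) (r : R) :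
  measurable_fun setT f -> measurable_fun setT g -> measurable_fun setT h ->
  (forall x, 0 <= f x <= 1) -> (forall x, 0 <= g x <= 1) ->
  (forall x, 0 <= h x) ->
  (forall t, t < 1 -> exists x, t < f x) ->
  (forall t, t < 1 -> exists x, t < g x) ->
  (forall x, f x != 0 -> `|x| <= r) -> (forall x, g x != 0 -> `|x| <= r) ->
  (forall x y, f x * g y <= h (x + y) ^+ 2) ->
  (\int[mu]_x (f x)%:E + \int[mu]_x (g x)%:E <= \int[mu]_x (h x)%:E)%E.
Proof.
move=> mf mg mh f01 g01 h0 f1 g1 fr gr fgh.
rewrite !layer_cake//; [|by move=> x; case/andP: (g01 x)|by move=> x; case/andP: (f01 x)].
rewrite -ge0_integralD//; [|exact: measurable_tail..].
apply: ge0_le_integral => //.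
- by move=> t _; rewrite adde_ge0.
- by apply: emeasurable_funD; exact: measurable_tail.
- exact: measurable_tail.
suff tail_le (t : R) : (mu [set x | (0 <= t < f x)%R] +
    mu [set x | (0 <= t < g x)%R] <= mu [set x | (0 <= t < h x)%R])%E.
  by move=> t _; exact: tail_le.
have tailm (k : R -> R) : measurable_fun setT k ->
    measurable [set x | 0 <= t < k x].
  move=> mk; have [t0|t0] := leP 0 t; first exact: measurable_gt_set.
  by rewrite (_ : [set _ | _] = set0)//; apply/seteqP; split.
case: (boolP (t < 0)) => [t0|]; last rewrite -leNgt => t0.
  have tail0 (k : R -> R) : mu [set x | 0 <= t < k x] = 0%E.
    rewrite (_ : [set _ | _] = set0) ?measure0//.
    by apply/seteqP; split => x //=; rewrite leNgt t0.
  by rewrite !tail0 adde0.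
have [t1|t1] := ltP t 1; last first.
  have tail0 (k : R -> R) : (forall x, 0 <= k x <= 1) ->
      mu [set x | 0 <= t < k x] = 0%E.
    move=> k01; rewrite (_ : [set _ | _] = set0) ?measure0//.
    apply/seteqP; split => x //= /andP[_ tk].
    by have /andP[_] := k01 x; rewrite leNgt (le_lt_trans t1 tk).
  by rewrite (tail0 f)// (tail0 g)// adde0.
apply: (@brunn_minkowski_line _ _ _ _ r); try exact: tailm.
- by have [x fx] := f1 _ t1; exists x => /=; rewrite t0.
- by have [x fx] := g1 _ t1; exists x => /=; rewrite t0.
- move=> x /=/andP[_ tf]; rewrite in_itv/= -ler_norml; apply: fr.
  by rewrite gt_eqF// (le_lt_trans t0).
- move=> x /=/andP[_ tf]; rewrite in_itv/= -ler_norml; apply: gr.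
  by rewrite gt_eqF// (le_lt_trans t0).
- move=> x y /= /andP[_ tf] /andP[_ tg]; rewrite t0/=.
  rewrite -(@ltr_pXn2r _ 2)// ?nnegrE//; apply: lt_le_trans (fgh x y).
  by rewrite expr2 ltr_pM.
Qed.

End prekopa_leindler.

Section gaussian_line.
Context {R : realType}.
Local Notation mu := (@lebesgue_measure R).

(** Dividing f and g by their suprema a and b, and h by sqrt (a b), reduces to
    suprema equal to 1. The sum so obtained dominates a product by the
    arithmetic-geometric inequality. *)
Lemma prekopa_leindler_line (f g h : R -> R) (M r c : R) :
  measurable_fun setT f -> measurable_fun setT g -> measurable_fun setT h ->
  (forall x, 0 <= f x <= M) -> (forall x, 0 <= g x <= M) ->
  (forall x, 0 <= h x) ->
  (forall x, f x != 0 -> `|x| <= r) -> (forall x, g x != 0 -> `|x| <= r) ->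
  (forall x y, f x * g y <= h (x + y) ^+ 2) ->
  (\int[mu]_x (h x)%:E <= (2 * c)%:E)%E ->
  ((\int[mu]_x (f x)%:E) * (\int[mu]_x (g x)%:E) <= (c ^+ 2)%:E)%E.
Proof.
move=> mf mg mh fM gM h0 fr gr fgh hc.
have f0 x : 0 <= f x by case/andP: (fM x).
have g0 x : 0 <= g x by case/andP: (gM x).
pose a := sup (range f); pose b := sup (range g).
have supf (k : R -> R) : (forall x, 0 <= k x <= M) -> has_sup (range k).
  move=> kM; split; first by exists (k 0); exists 0.
  by exists M => _ [x _ <-]; case/andP: (kM x).
have fa x : f x <= a by apply: ub_le_sup; [have [] := supf _ fM|exists x].
have gb x : g x <= b by apply: ub_le_sup; [have [] := supf _ gM|exists x].
have null (k : R -> R) : (forall x, 0 <= k x) -> (forall x, k x <= 0) ->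
    (\int[mu]_x (k x)%:E = 0)%E.
  move=> k0 k0'; apply: integral0_eq => x _; congr EFin.
  by apply/le_anti; rewrite k0 k0'.
have [a0|a0] := leP a 0.
  rewrite (null f)// ?mul0e ?lee_fin ?sqr_ge0// => x.
  exact: le_trans (fa x) a0.
have [b0|b0] := leP b 0.
  rewrite (null g)// ?mule0 ?lee_fin ?sqr_ge0// => x.
  exact: le_trans (gb x) b0.
pose s := Num.sqrt (a * b).
have s0 : 0 < s by rewrite sqrtr_gt0 mulr_gt0.
have ss : s ^+ 2 = a * b by rewrite sqr_sqrtr// mulr_ge0// ltW.
have sup1 (k : R -> R) l : (forall x, 0 <= k x <= M) -> l = sup (range k) ->
    0 < l -> forall t, t < 1 -> exists x, t < k x * l^-1.
  move=> kM le l0 t t1.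
  have : (1 - t) * l > 0 by rewrite mulr_gt0// subr_gt0.
  move/sup_adherent => /(_ _ (supf _ kM)) [_ [x _ <-]].
  rewrite -le mulrBl mul1r opprB addrCA subrr addr0 => tl.
  by exists x; rewrite ltr_pdivlMr.
have key : (\int[mu]_x (f x * a^-1)%:E + \int[mu]_x (g x * b^-1)%:E <=
    \int[mu]_x (h x * s^-1)%:E)%E.
  apply: (@prekopa_leindler_sup1 _ _ _ _ r).
  - exact: measurable_funM.
  - exact: measurable_funM.
  - exact: measurable_funM.
  - by move=> x; rewrite ler_pdivrMr// mul1r fa andbT divr_ge0// ltW.
  - by move=> x; rewrite ler_pdivrMr// mul1r gb andbT divr_ge0// ltW.
  - by move=> x; rewrite divr_ge0// ltW.
  - exact: sup1.
  - exact: sup1.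
  - by move=> x fx; apply: fr; apply: contra_neq fx => ->; rewrite mul0r.
  - by move=> x gx; apply: gr; apply: contra_neq gx => ->; rewrite mul0r.
  - move=> x y; rewrite mulrACA -invfM exprMn exprVn ss.
    by rewrite ler_pM2r// invr_gt0 mulr_gt0.
have intZ (k : R -> R) (l : R) : measurable_fun setT k -> (forall x, 0 <= k x) ->
    0 < l ->
    (\int[mu]_x (k x * l^-1)%:E = (\int[mu]_x (k x)%:E) * (l^-1)%:E)%E.
  move=> mk k0 l0; under eq_integral do rewrite EFinM.
  rewrite ge0_integralZr//; first exact/measurable_EFinP.
  - by move=> x _; rewrite lee_fin.
  - by rewrite lee_fin invr_ge0 ltW.
rewrite !intZ// in key.
have If0 : (0 <= \int[mu]_x (f x)%:E)%E by apply: integral_ge0 => x _; rewrite lee_fin.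
have Ig0 : (0 <= \int[mu]_x (g x)%:E)%E by apply: integral_ge0 => x _; rewrite lee_fin.
have is0 : 0 <= s^-1 by rewrite invr_ge0 ltW.
have is0E : (0 <= (s^-1)%:E)%E by rewrite lee_fin.
have {}key := le_trans key (lee_wpmul2r is0E hc); rewrite -EFinM in key.
move: (\int[mu]_x (f x)%:E)%E (\int[mu]_x (g x)%:E)%E If0 Ig0 key.
have ia0 : 0 < a^-1 by rewrite invr_gt0.
have ib0 : 0 < b^-1 by rewrite invr_gt0.
have yia : (+oo * (a^-1)%:E = +oo)%E by rewrite gt0_mulye// lte_fin.
have yib : (+oo * (b^-1)%:E = +oo)%E by rewrite gt0_mulye// lte_fin.
move=> [u||] [v||] //= u0 v0 uv;
  try by move: uv; rewrite ?yia ?yib /= leye_eq.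
rewrite -!EFinM -EFinD lee_fin in uv.
rewrite -EFinM lee_fin.
rewrite !lee_fin in u0 v0 *.
have uv2 : (u / a + v / b) ^+ 2 <= (2 * c / s) ^+ 2.
  by rewrite ler_pXn2r// nnegrE; [|apply: le_trans uv]; rewrite addr_ge0// divr_ge0// ltW.
have : 4 * (u / a * (v / b)) <= 4 * (c ^+ 2 / (a * b)).
  rewrite -ss; apply: (@le_trans _ _ ((u / a + v / b) ^+ 2)).
    by have := sqr_ge0 (u / a - v / b); lra.
  apply: (le_trans uv2); rewrite !exprMn exprVn; lra.
rewrite ler_pM2l// mulrACA -invfM ler_pM2r//.
by rewrite invr_gt0 mulr_gt0.
Qed.

Lemma ge0_integral_normal_prob (m s : R) (f : R -> \bar R) :
  measurable_fun setT f -> (forall x, 0 <= f x)%E ->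
  (\int[normal_prob m s]_x f x = \int[mu]_x (f x * (normal_pdf m s x)%:E))%E.
Proof.
move=> mf f0.
rewrite -(Radon_Nikodym_SigmaFinite.change_of_variables (normal_prob_dominates m s) f0)//.
have dom := normal_prob_dominates m s.
have RNint := Radon_Nikodym_SigmaFinite.f_integrable dom.
apply: ae_eq_integral => //.
- apply: emeasurable_funM => //; exact: (measurable_int mu).
- apply: emeasurable_funM => //=; apply/measurableT_comp => //=.
  exact: measurable_normal_pdf.
- apply: ae_eqe_mul2l => /=.
  apply: integral_ae_eq => //=.
  + by apply/measurableT_comp => //; exact: measurable_normal_pdf.
  + by move=> E E01 mE; rewrite -Radon_Nikodym_SigmaFinite.f_integral.
Qed.

(* [normal_prob] lives on [measurableTypeR R], the law of a real random variable
   on [R] itself; these two measurable types have the same sets but different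
   displays, and the identity between them transports the measure. *)
Let measurable_fun_idR :
  measurable_fun setT (idfun : measurableTypeR R -> R).
Proof. by move=> _ B mB; rewrite setTI. Qed.

Let idR : {mfun measurableTypeR R >-> R} :=
  HB.pack (idfun : measurableTypeR R -> R)
    (isMeasurableFun.Build _ _ _ _ _ measurable_fun_idR).

Lemma exists_gaussian : exists gamma : probability R R,
  forall B, measurable B -> gamma B = normal_prob 0 1 B.
Proof. by exists (distribution (normal_prob 0 1) idR). Qed.

Lemma ge0_integral_gaussian (gamma : {measure set R -> \bar R})
    (f : R -> \bar R) :
  (forall B, measurable B -> gamma B = normal_prob 0 1 B) ->
  measurable_fun setT f -> (forall x, 0 <= f x)%E ->
  (\int[gamma]_x f x = \int[mu]_x (f x * (normal_pdf 0 1 x)%:E))%E.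
Proof.
move=> gammaE mf f0.
rewrite -(ge0_integral_normal_prob 0 1 mf f0).
rewrite (@eq_measure_integral _ _ _ _ (distribution (normal_prob 0 1) idR)).
  by rewrite ge0_integral_distribution.
by move=> B mB _; exact: gammaE.
Qed.

End gaussian_line.

(** * Property (tau) of Gaussian vectors *)

(** Maurey's property (tau) is usually stated as: the integral of exp (Q f)
    times that of exp (- f) is at most 1, where Q f is the infimal convolution
    of f with the cost c. Replacing exp (Q f) and exp (- f) by any two functions
    f and g removes the infimum, hence all questions about the measurability of
    Q f. *)
Definition property_tau d (T : measurableType d) (R : realType)
    (mu : set T -> \bar R) (c : T -> T -> R) :=
  forall f g : T -> \bar R,
    measurable_fun setT f -> measurable_fun setT g ->
    (forall x, 0 <= f x)%E -> (forall x, 0 <= g x)%E ->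
    (forall x y, f x * g y <= (expR (c x y))%:E)%E ->
    (\int[mu]_x f x * \int[mu]_x g x <= 1)%E.

Section property_tau.
Context {R : realType}.
Local Notation mu := (@lebesgue_measure R).
Local Notation pdf := (@normal_pdf R 0 1).

Let h (z : R) := 2 * normal_pdf 0 2 z.

(* The parallelogram identity (x - y)^2 + (x + y)^2 = 2 x^2 + 2 y^2. *)
Let pdfM (x y : R) :
  pdf x * pdf y * expR ((x - y) ^+ 2 / 4) = h (x + y) ^+ 2.
Proof.
rewrite /h !normal_pdfE ?oner_eq0// /normal_peak /normal_fun.
rewrite !exprMn expr1n mul1r !subr0.
have -> : (Num.sqrt ((2 : R) ^+ 2 * pi *+ 2))^-1 = 2^-1 * (Num.sqrt (pi *+ 2))^-1.
  rewrite -mulrnAr sqrtrM ?sqr_ge0// sqrtr_sqr ger0_norm// invfM//.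
set a := (Num.sqrt (pi *+ 2))^-1.
have -> : 2 ^+ 2 * ((2^-1 * a) ^+ 2 * expR (- (x + y) ^+ 2 / (2 ^+ 2 *+ 2)) ^+ 2) =
    a ^+ 2 * expR (- (x + y) ^+ 2 / (2 ^+ 2 *+ 2)) ^+ 2 :> R by field.
rewrite mulrACA -expr2 -!mulrA -expRM_natl -!expRD.
by congr (a * (a * expR _)); field.
Qed.

Import HBNNSimple.

(** This is the Prekopa-Leindler inequality for f pdf, g pdf and h. That
    inequality asks for bounded functions with bounded support, so f and g are
    approximated from below. *)
Lemma property_tau_gaussian (gamma : {measure set R -> \bar R}) :
  (forall B, measurable B -> gamma B = normal_prob 0 1 B) ->
  property_tau gamma (fun x y => (x - y) ^+ 2 / 4).
Proof.
move=> gammaE f g mf mg f0 g0 fg.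
rewrite !(ge0_integral_gaussian gammaE)//.
pose box n : set R := `[- n%:R, n%:R]%classic.
pose trunc (k : R -> \bar R) (mk : measurable_fun setT k) n x : R :=
  nnsfun_approx measurableT mk n x * (pdf x * \1_(box n) x).
have box_ge0 n x : 0 <= \1_(box n) x :> R by rewrite indicE.
have trunc_ge0 k mk n x : 0 <= trunc k mk n x.
  by rewrite !mulr_ge0// ?normal_pdf_ge0.
have mtrunc k mk n : measurable_fun setT (trunc k mk n).
  apply: measurable_funM => //; apply: measurable_funM.
    exact: measurable_normal_pdf.
  by apply: measurable_indic; exact: measurable_itv.
have trunc_le k mk n x : (forall x, 0 <= k x)%E ->
    ((trunc k mk n x)%:E <= k x * (pdf x)%:E)%E.
  move=> k0; rewrite EFinM lee_pmul ?lee_fin//.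
  - by rewrite mulr_ge0// normal_pdf_ge0.
  - apply: (cvge_ge _ (@cvg_nnsfun_approx _ _ _ _ measurableT _ mk _ x _)) => //.
    exists n => // m /= nm; rewrite lee_fin.
    exact/lefP/nd_nnsfun_approx.
  - by rewrite ler_piMr ?normal_pdf_ge0// indicE lern1 leq_b1.
have trunc_ndec k mk x : {homo trunc k mk ^~ x : m n / (m <= n)%N >-> m <= n}.
  move=> m n mn; apply: ler_pM => //.
  - by rewrite mulr_ge0// normal_pdf_ge0.
  - exact/lefP/nd_nnsfun_approx.
  - rewrite ler_wpM2l ?normal_pdf_ge0// !indicE ler_nat.
    case: (boolP (x \in box m)) => [|_]; last by rewrite leq0n.
    move=> /set_mem; rewrite /box/= in_itv/= -ler_norml => xm.
    rewrite mem_set// /box/= in_itv/= -ler_norml (le_trans xm)// ler_nat.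
    exact: mn.
have trunc_cvg k mk : (forall x, 0 <= k x)%E ->
    (\int[mu]_x (trunc k mk n x)%:E @[n --> \oo] -->
     \int[mu]_x (k x * (pdf x)%:E))%E.
  move=> k0.
  have cvg_pt x : ((trunc k mk n x)%:E @[n --> \oo] --> k x * (pdf x)%:E)%E.
    apply: (@cvg_trans _ ((nnsfun_approx measurableT mk n x)%:E * (pdf x)%:E
        @[n --> \oo])%E); last first.
      by apply: cvgeZr => //; exact: cvg_nnsfun_approx.
    apply: near_eq_cvg; near=> n.
    rewrite /trunc indicE mem_set ?mulr1 ?EFinM// /box/= in_itv/= -ler_norml.
    by near: n; exact: nbhs_infty_ger.
  under eq_integral do rewrite -(cvg_lim _ (cvg_pt _))//.
  apply: cvg_monotone_convergence => //.
  - by move=> n; apply/measurable_EFinP; exact: mtrunc.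
  - by move=> n x _; rewrite lee_fin.
  - by move=> x _ m n mn; rewrite lee_fin; exact: trunc_ndec.
have trunc_bound k mk n : exists M, forall x, 0 <= trunc k mk n x <= M.
  have [B [_ /(_ (`|B| + 1)) kB]] := simple_bounded (nnsfun_approx measurableT mk n).
  exists ((`|B| + 1) * normal_peak 1) => x; rewrite trunc_ge0/=.
  apply: ler_pM => //.
  - by rewrite mulr_ge0// normal_pdf_ge0.
  - apply: le_trans (ler_norm _) (kB _ x _) => //.
    by rewrite (le_lt_trans (ler_norm B))// ltrDl.
  - apply: le_trans (normal_pdf_ub 0 x (oner_neq0 R)).
    by rewrite ler_piMr ?normal_pdf_ge0// indicE lern1 leq_b1.
have trunc_tau n :
    (\int[mu]_x (trunc f mf n x)%:E * \int[mu]_x (trunc g mg n x)%:E <= 1)%E.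
  have [M1 fM1] := trunc_bound f mf n; have [M2 gM2] := trunc_bound g mg n.
  rewrite -(expr1n _ 2).
  apply: (@prekopa_leindler_line _ _ _ h (Num.max M1 M2) n%:R) => //.
  - by apply: measurable_funM => //; exact: measurable_normal_pdf.
  - by move=> x; case/andP: (fM1 x) => -> /= ?; rewrite le_max; apply/orP; left.
  - by move=> x; case/andP: (gM2 x) => -> /= ?; rewrite le_max; apply/orP; right.
  - by move=> x; rewrite mulr_ge0// normal_pdf_ge0.
  - move=> x; rewrite /trunc indicE; case: (boolP (_ \in _)).
      by move=> /set_mem; rewrite /box/= in_itv/= -ler_norml.
    by rewrite !mulr0 eqxx.
  - move=> x; rewrite /trunc indicE; case: (boolP (_ \in _)).
      by move=> /set_mem; rewrite /box/= in_itv/= -ler_norml.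
    by rewrite !mulr0 eqxx.
  - move=> x y; rewrite -pdfM -lee_fin EFinM.
    apply: (le_trans (lee_pmul _ _ (trunc_le _ _ _ _ f0) (trunc_le _ _ _ _ g0))).
    + by rewrite lee_fin.
    + by rewrite lee_fin.
    + rewrite muleACA -EFinM muleC [leRHS]EFinM; apply: lee_wpmul2l => //.
      by rewrite lee_fin mulr_ge0// normal_pdf_ge0.
  - under eq_integral do rewrite EFinM.
    rewrite ge0_integralZl//; last 2 first.
      by apply/measurable_EFinP; exact: measurable_normal_pdf.
      by move=> x _; rewrite lee_fin normal_pdf_ge0.
    by rewrite integral_normal_pdf mule1 mulr1.
have If0 : (0 <= \int[mu]_x (f x * (pdf x)%:E))%E.
  by apply: integral_ge0 => x _; rewrite mule_ge0// lee_fin normal_pdf_ge0.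
have Ig0 : (0 <= \int[mu]_x (g x * (pdf x)%:E))%E.
  by apply: integral_ge0 => x _; rewrite mule_ge0// lee_fin normal_pdf_ge0.
have := trunc_cvg f mf f0; have := trunc_cvg g mg g0.
move: (\int[mu]_x (f x * (pdf x)%:E))%E (\int[mu]_x (g x * (pdf x)%:E))%E If0 Ig0.
move=> u v u0 v0 cv cu.
have [->|un0] := eqVneq u 0%E; first by rewrite mul0e.
have [->|vn0] := eqVneq v 0%E; first by rewrite mule0.
have def : (u *? v)%E by rewrite /mule_def; case: u v u0 v0 un0 vn0 {cv cu} => [u||] [v||].
apply: cvge_le (cvgeM def cu cv).
by apply: nearW => n; exact: trunc_tau.
Unshelve. all: by end_near. Qed.

End property_tau.

Section property_tau_theory.
Local Open Scope ereal_scope.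
Context {R : realType}.

Lemma property_tau_distribution d d' (T : measurableType d)
    (T' : measurableType d') (P : probability T R) (X : {mfun T >-> T'})
    (c : T' -> T' -> R) :
  property_tau P (fun x y => c (X x) (X y)) -> property_tau (distribution P X) c.
Proof.
move=> tauP f g mf mg f0 g0 fg; rewrite !ge0_integral_distribution//.
apply: tauP => //.
- exact: (measurableT_comp mf (measurable_funPT X)).
- exact: (measurableT_comp mg (measurable_funPT X)).
- by move=> x; exact: f0.
- by move=> x; exact: g0.
- by move=> x y; exact: fg.
Qed.

(** For fixed first coordinates x and y, the property of m2 applies to the
    sections f(x, .) and g(y, .), one of them multiplied by exp (- c1 x y). It
    shows that the partial integrals of f and g satisfy the hypothesis of the
    property of m1. *)
Lemma property_tau_prod d1 d2 (T1 : measurableType d1) (T2 : measurableType d2)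
    (m1 : {sigma_finite_measure set T1 -> \bar R})
    (m2 : {sigma_finite_measure set T2 -> \bar R})
    (c1 : T1 -> T1 -> R) (c2 : T2 -> T2 -> R) :
  property_tau m1 c1 -> property_tau m2 c2 ->
  property_tau (m1 \x m2) (fun x y => c1 x.1 y.1 + c2 x.2 y.2)%R.
Proof.
move=> tau1 tau2 f g mf mg f0 g0 fg; rewrite !fubini_tonelli1//.
apply: tau1.
- exact: measurable_fun_fubini_tonelli_F.
- exact: measurable_fun_fubini_tonelli_F.
- by move=> x; exact: integral_ge0.
- by move=> x; exact: integral_ge0.
move=> x y; rewrite /fubini_F.
have mfx : measurable_fun setT (fun z => f (x, z)).
  exact: measurable_fun_pair2.
have mgy : measurable_fun setT (fun z => g (y, z)).
  exact: measurable_fun_pair2.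
have e0 : (0 < expR (c1 x y))%R := expR_gt0 _.
have := tau2 (fun z => (expR (- c1 x y))%:E * f (x, z)) (fun z => g (y, z)).
rewrite ge0_integralZl ?lee_fin ?expR_ge0//.
rewrite -muleA expRN lee_pdivrMl// mule1; apply => //.
- exact: emeasurable_funM.
- by move=> z; rewrite mule_ge0// lee_fin invr_ge0 expR_ge0.
- move=> z w; rewrite -muleA lee_pdivrMl// -EFinM -expRD.
  exact: fg (x, z) (y, w).
Qed.

End property_tau_theory.

Section rectangles.
Context d (T : measurableType d) (n : nat).

Definition rectangle (B : 'I_n -> set T) : set (n.-tuple T) :=
  [set w | forall i, B i (tnth w i)].

Definition rectangles : set (set (n.-tuple T)) :=
  [set rectangle B | B in [set B | forall i, measurable (B i)]].

Lemma measurable_rectangle B : (forall i, measurable (B i)) ->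
  measurable (rectangle B).
Proof.
move=> mB; rewrite (_ : rectangle B = \bigcap_(i in setT) (tnth (T := T) ^~ i @^-1` B i)).
  apply: fin_bigcap_measurable => // i _; rewrite -[_ @^-1` _]setTI.
  exact: measurable_tnth.
by apply/seteqP; split => [w Bw i _|w Bw i]; exact: Bw.
Qed.

(** Each preimage of a set by a coordinate, which generate the measurable sets of
    tuples, is itself a rectangle with all other sides full. *)
Lemma measurable_rectanglesE :
  (measurable : set (set (n.-tuple T))) = <<s rectangles >>.
Proof.
apply/seteqP; split; last first.
  apply: smallest_sub; first exact: sigma_algebra_measurable.
  by move=> _ [B mB <-]; exact: measurable_rectangle.
apply: smallest_sub; first exact: smallest_sigma_algebra.
rewrite -bigcup_seq => _ [i _ [B mB <-]].
apply: sub_sigma_algebra; exists (fun j => if j == i then B else setT).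
  by move=> j; case: ifP.
rewrite setTI; apply/seteqP; split => w /=.
  by move=> /(_ i); rewrite eqxx.
by move=> Bw j; case: eqP => // ->.
Qed.

Lemma rectangle_measure_unique (R : realType)
    (m1 m2 : probability (n.-tuple T) R) :
  (forall B, (forall i, measurable (B i)) ->
     m1 (rectangle B) = m2 (rectangle B)) ->
  forall A, measurable A -> m1 A = m2 A.
Proof.
move=> m12 A mA.
apply: (measure_unique rectangles (fun=> setT)) => //.
- exact: measurable_rectanglesE.
- move=> _ _ [B mB <-] [C mC <-]; exists (fun i => B i `&` C i).
    by move=> i; exact: measurableI.
  apply/seteqP; split => w /= => [BC|[Bw Cw] i]; last by split.
  by split => i; have [] := BC i.
- move=> _; exists (fun=> setT) => //.
  by apply/seteqP; split.
- by apply/seteqP; split => // x _; exists 0%N.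
- by move=> _ [B mB <-]; exact: m12.
- by move=> _; rewrite (le_lt_trans (probability_le1 _ _))// ltry.
Qed.

End rectangles.

Section gaussian_vector.
Local Open Scope ereal_scope.
Context {R : realType}.

Let cons_tuple n (p : R * n.-tuple R) : n.+1.-tuple R := [tuple of p.1 :: p.2].

Let measurable_cons_tuple n : measurable_fun setT (@cons_tuple n).
Proof. by apply: measurable_cons. Qed.

Let cons_mfun n : {mfun (R * n.-tuple R)%type >-> n.+1.-tuple R} :=
  HB.pack (@cons_tuple n)
    (isMeasurableFun.Build _ _ _ _ _ (@measurable_cons_tuple n)).

(** Up to the factor sqrt 2, the product of exp (x^2 / 4) with the standard
    normal density is the density of variance 2. *)
Lemma integral_expR_sqr_gaussian (gamma : {measure set R -> \bar R}) :
  (forall B, measurable B -> gamma B = normal_prob 0 1 B) ->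
  \int[gamma]_x (expR (x ^+ 2 / 4))%:E = (Num.sqrt 2)%:E.
Proof.
move=> gammaE.
have s20 : (Num.sqrt 2 : R) != 0%R by rewrite sqrtr_eq0 -ltNge.
rewrite (ge0_integral_gaussian gammaE); last 2 first.
- apply/measurable_EFinP; apply: measurableT_comp => //.
  by apply: measurable_funM => //; exact: measurable_funX.
- by move=> x; rewrite lee_fin expR_ge0.
transitivity (\int[lebesgue_measure]_x
    ((Num.sqrt 2)%:E * (normal_pdf 0 (Num.sqrt 2 : R) x)%:E)); last first.
  rewrite ge0_integralZl ?lee_fin ?sqrtr_ge0//.
  - by rewrite integral_normal_pdf mule1.
  - by apply/measurable_EFinP; exact: measurable_normal_pdf.
  - by move=> x _; rewrite lee_fin normal_pdf_ge0.
apply: eq_integral => x _; rewrite -!EFinM; congr EFin.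
rewrite !normal_pdfE ?oner_eq0// /normal_peak /normal_fun !subr0.
rewrite expr1n mul1r sqr_sqrtr// -mulrnAr sqrtrM// invfM.
rewrite mulrCA -expRD -[in RHS]mulrA mulVKf//; congr (_ * expR _)%R.
by field.
Qed.

Lemma measurable_sum_sqr n :
  measurable_fun setT (fun x : n.-tuple R => \sum_(i < n) tnth x i ^+ 2 / 4)%R.
Proof.
apply: measurable_sum => i; apply: measurable_funM => //.
by apply: measurable_funX; exact: measurable_tnth.
Qed.

Let measurable_expR_sum_sqr n : measurable_fun setT
  (fun x : n.-tuple R => (expR (\sum_(i < n) tnth x i ^+ 2 / 4))%:E).
Proof.
by apply/measurable_EFinP; apply: measurableT_comp => //; exact: measurable_sum_sqr.
Qed.

(** The law is built by adding one independent coordinate at a time, along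
    with the two facts about it that survive this step. *)
Lemma exists_gaussian_vector n : exists mu : probability (n.-tuple R) R,
  [/\ forall B, (forall i, measurable (B i)) ->
        mu (rectangle B) = \prod_(i < n) normal_prob 0 1 (B i),
      property_tau mu
        (fun x y => \sum_(i < n) (tnth x i - tnth y i) ^+ 2 / 4)%R &
      \int[mu]_x (expR (\sum_(i < n) tnth x i ^+ 2 / 4))%:E =
        (Num.sqrt 2 ^+ n)%:E].
Proof.
have [gamma gammaE] := @exists_gaussian R.
elim: n => [|n [mu [muB mutau muexp]]].
  exists (dirac ([tuple] : 0.-tuple R)); split.
  - move=> B _; rewrite big_ord0 /= diracE mem_set//.
    by case.
  - move=> f g mf mg f0 g0 fg; rewrite !integral_dirac//.
    rewrite !diracT !mul1e.
    by have := fg [tuple] [tuple]; rewrite big_ord0 expR0.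
  - rewrite integral_dirac//; last first.
      exact: measurable_expR_sum_sqr.
    by rewrite diracT mul1e big_ord0 expR0 expr0.
have prodT : (gamma \x mu) setT = 1.
  transitivity (gamma setT * mu setT); last by rewrite !probability_setT mule1.
  by rewrite -setXTT; exact: product_measure1E.
pose nu : probability (R * n.-tuple R)%type R :=
  HB.pack (gamma \x mu) (Measure_isProbability.Build _ _ _ (gamma \x mu) prodT).
exists (distribution nu (cons_mfun n)); split.
- move=> B mB; rewrite big_ord_recl -gammaE// -muB//.
  rewrite -product_measure1E//; last exact: measurable_rectangle.
  apply: (congr1 (gamma \x mu)); apply/seteqP; split => -[x w] /=.
    move=> H; split => /=.
      by have := H ord0.
    by move=> i; have := H (lift ord0 i); rewrite tnthS.
  move=> [Bx Bw] i; case: (unliftP ord0 i) => [j|] ->//.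
  by rewrite tnthS.
- apply: property_tau_distribution.
  have := property_tau_prod (property_tau_gaussian gammaE) mutau.
  congr property_tau; apply/funext => x; apply/funext => y.
  rewrite big_ord_recl/=; congr (_ + _)%R.
  by apply: eq_bigr => i _; rewrite !tnthS.
- rewrite ge0_integral_distribution//; last exact: measurable_expR_sum_sqr.
  transitivity (\int[gamma \x mu]_p ((expR (p.1 ^+ 2 / 4))%:E *
      (expR (\sum_(i < n) tnth p.2 i ^+ 2 / 4))%:E)).
    apply: eq_integral => -[x w] _ /=; rewrite big_ord_recl -EFinM -expRD /=.
    congr (expR (_ + _))%:E.
    by apply: eq_bigr => i _; rewrite tnthS.
  have mexp1 : measurable_fun setT (fun x : R => (expR (x ^+ 2 / 4))%:E).
    apply/measurable_EFinP; apply: measurableT_comp => //.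
    by apply: measurable_funM => //; exact: measurable_funX.
  rewrite fubini_tonelli1//; last first.
    apply: emeasurable_funM; first exact: (measurableT_comp mexp1).
    exact: (measurableT_comp (@measurable_expR_sum_sqr n)).
  transitivity (\int[gamma]_x ((expR (x ^+ 2 / 4))%:E * (Num.sqrt 2 ^+ n)%:E)).
    apply: eq_integral => x _; rewrite /fubini_F/= -muexp.
    rewrite ge0_integralZl ?lee_fin ?expR_ge0//.
    exact: measurable_expR_sum_sqr.
  rewrite ge0_integralZr ?lee_fin ?exprn_ge0 ?sqrtr_ge0//.
  by rewrite (integral_expR_sqr_gaussian gammaE) -EFinM exprS.
Qed.

End gaussian_vector.

(** * Euclidean and operator norms *)

Section euclidean_norm.
Context {R : realType}.

Lemma enorm_ge0 n (u : 'cV[R]_n) : 0 <= enorm u.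
Proof. exact: sqrtr_ge0. Qed.

Lemma sqr_enorm n (u : 'cV[R]_n) : enorm u ^+ 2 = \sum_(i < n) u i 0 ^+ 2.
Proof. by rewrite sqr_sqrtr// sumr_ge0// => i _; exact: sqr_ge0. Qed.

Lemma dotE n (u v : 'cV[R]_n) :
  (u^T *m v) 0 0 = \sum_(i < n) u i 0 * v i 0.
Proof. by rewrite mxE; apply: eq_bigr => i _; rewrite mxE. Qed.

Lemma sqr_enorm_dot n (u : 'cV[R]_n) : enorm u ^+ 2 = (u^T *m u) 0 0.
Proof. by rewrite sqr_enorm dotE; apply: eq_bigr => i _; rewrite expr2. Qed.

Lemma enorm_le n (u : 'cV[R]_n) (r : R) :
  0 <= r -> \sum_(i < n) u i 0 ^+ 2 <= r ^+ 2 -> enorm u <= r.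
Proof. by move=> r0; rewrite -sqr_enorm ler_pXn2r// nnegrE enorm_ge0. Qed.

Lemma enorm0_eq0 n (u : 'cV[R]_n) : enorm u = 0 -> u = 0.
Proof.
move=> /(congr1 (fun x => x ^+ 2)); rewrite sqr_enorm expr0n/= => /eqP.
rewrite psumr_eq0 => [/allP u0|i _]; last exact: sqr_ge0.
apply/matrixP => i j; rewrite ord1 mxE; apply/eqP.
by rewrite -sqrf_eq0; apply: u0; rewrite mem_index_enum.
Qed.

Lemma enormZ n (a : R) (u : 'cV[R]_n) : enorm (a *: u) = `|a| * enorm u.
Proof.
rewrite /enorm -sqrtr_sqr -sqrtrM ?sqr_ge0//; congr Num.sqrt.
by rewrite mulr_sumr; apply: eq_bigr => i _; rewrite mxE exprMn.
Qed.

Lemma enorm0 n : enorm (0 : 'cV[R]_n) = 0.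
Proof. by rewrite -(scale0r 0) enormZ normr0 mul0r. Qed.

Lemma enormN n (u : 'cV[R]_n) : enorm (- u) = enorm u.
Proof. by rewrite -scaleN1r enormZ normrN1 mul1r. Qed.

Lemma enorm_const n (a : R) : enorm (const_mx a : 'cV[R]_n) = Num.sqrt n%:R * `|a|.
Proof.
rewrite /enorm -sqrtr_sqr -sqrtrM//; congr Num.sqrt.
under eq_bigr do rewrite mxE.
by rewrite sumr_const card_ord mulr_natl.
Qed.

(** The square of the norm of |u|^2 v - (u . v) u equals
    |u|^2 (|u|^2 |v|^2 - (u . v)^2). *)
Lemma cauchy_schwarz n (u v : 'cV[R]_n) :
  `|(u^T *m v) 0 0| <= enorm u * enorm v.
Proof.
have [u0|u0] := eqVneq (enorm u) 0.
  by rewrite u0 (enorm0_eq0 u0) trmx0 mul0mx mxE normr0 mul0r.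
have un0 : 0 < enorm u ^+ 2 by rewrite exprn_even_gt0.
rewrite -(@ler_pXn2r _ 2)// ?nnegrE ?mulr_ge0 ?enorm_ge0//.
rewrite real_normK ?num_real// exprMn.
set a := (u^T *m v) 0 0.
have : 0 <= enorm (enorm u ^+ 2 *: v - a *: u) ^+ 2 by exact: sqr_ge0.
have -> : enorm (enorm u ^+ 2 *: v - a *: u) ^+ 2 =
    enorm u ^+ 2 * (enorm u ^+ 2 * enorm v ^+ 2 - a ^+ 2).
  set N := enorm u ^+ 2.
  transitivity (\sum_(i < n) (N ^+ 2 * v i 0 ^+ 2 + (- (2 * N * a)) * (u i 0 * v i 0)
      + a ^+ 2 * u i 0 ^+ 2)).
    by rewrite sqr_enorm; apply: eq_bigr => i _; rewrite !mxE; ring.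
  rewrite !big_split/= -!mulr_sumr -!sqr_enorm -dotE -/a -/N.
  by ring.
by rewrite pmulr_rge0// subr_ge0.
Qed.

Lemma enormD n (u v : 'cV[R]_n) : enorm (u + v) <= enorm u + enorm v.
Proof.
rewrite -(@ler_pXn2r _ 2)// ?nnegrE ?addr_ge0 ?enorm_ge0//.
have -> : enorm (u + v) ^+ 2 = enorm u ^+ 2 + enorm v ^+ 2 + 2 * (u^T *m v) 0 0.
  rewrite !sqr_enorm dotE mulr_sumr -!big_split/=.
  by apply: eq_bigr => i _; rewrite mxE; ring.
have := le_trans (ler_norm _) (cauchy_schwarz u v).
lra.
Qed.

Lemma enorm_lipschitz n (f : R -> R) (l : R) (u v : 'cV[R]_n) :
  0 <= l -> (forall x y, `|f x - f y| <= l * `|x - y|) ->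
  enorm (map_mx f u - map_mx f v) <= l * enorm (u - v).
Proof.
move=> l0 fl; apply: enorm_le; first by rewrite mulr_ge0// enorm_ge0.
rewrite exprMn sqr_enorm mulr_sumr ler_sum// => i _; rewrite !mxE.
rewrite -real_normK ?num_real// -[X in _ * X]real_normK ?num_real// -exprMn.
by rewrite ler_pXn2r// nnegrE// mulr_ge0.
Qed.

End euclidean_norm.

Section operator_norm.
Context {R : realType}.

Let opset m n (A : 'M[R]_(m, n)) :=
  [set enorm (A *m u) | u in [set u : 'cV[R]_n | enorm u <= 1]].

Let has_sup_opset m n (A : 'M[R]_(m, n)) : has_sup (opset A).
Proof.
split; first by exists (enorm (A *m 0)), 0 => //=; rewrite enorm0.
exists (Num.sqrt (\sum_(i < m) enorm (row i A)^T ^+ 2)) => _ [u /= u1 <-].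
apply: enorm_le; first exact: sqrtr_ge0.
rewrite sqr_sqrtr; last by rewrite sumr_ge0// => i _; exact: sqr_ge0.
apply: ler_sum => i _.
have -> : (A *m u) i 0 = (((row i A)^T)^T *m u) 0 0.
  by rewrite trmxK -row_mul [RHS]mxE.
rewrite -real_normK ?num_real// ler_pXn2r// ?nnegrE ?enorm_ge0//.
by rewrite (le_trans (cauchy_schwarz _ _))// ler_piMr ?enorm_ge0.
Qed.

Lemma opnorm_ge0 m n (A : 'M[R]_(m, n)) : 0 <= opnorm A.
Proof.
apply: (@le_trans _ _ (enorm (A *m 0))); first exact: enorm_ge0.
apply: ub_le_sup; first by case: (has_sup_opset A).
by exists 0 => //=; rewrite enorm0.
Qed.

Lemma le_opnorm m n (A : 'M[R]_(m, n)) (u : 'cV[R]_n) :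
  enorm (A *m u) <= opnorm A * enorm u.
Proof.
have [u0|u0] := eqVneq (enorm u) 0.
  by rewrite u0 (enorm0_eq0 u0) mulmx0 enorm0 mulr0.
have {}u0 : 0 < enorm u by rewrite lt_def u0 enorm_ge0.
rewrite -ler_pdivrMr// mulrC.
have <- : enorm (A *m ((enorm u)^-1 *: u)) = (enorm u)^-1 * enorm (A *m u).
  by rewrite -scalemxAr enormZ ger0_norm// invr_ge0 ltW.
apply: ub_le_sup; first by case: (has_sup_opset A).
exists ((enorm u)^-1 *: u) => //=.
by rewrite enormZ ger0_norm ?invr_ge0 ?(ltW u0)// mulVf// gt_eqF.
Qed.

(** |A^T v|^2 = v . (A A^T v) <= |v| |A| |A^T v|. *)
Lemma opnorm_trmx_le m n (A : 'M[R]_(m, n)) (v : 'cV[R]_m) :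
  enorm (A^T *m v) <= opnorm A * enorm v.
Proof.
have [->|w0] := eqVneq (enorm (A^T *m v)) 0.
  by rewrite mulr_ge0 ?opnorm_ge0 ?enorm_ge0.
have {}w0 : 0 < enorm (A^T *m v) by rewrite lt_def w0 enorm_ge0.
rewrite -(ler_pM2r w0) -expr2 sqr_enorm_dot trmx_mul trmxK -mulmxA.
apply: le_trans (ler_norm _) _; apply: le_trans (cauchy_schwarz _ _) _.
by rewrite mulrC mulrAC ler_wpM2r ?enorm_ge0// le_opnorm.
Qed.

Lemma opnormN m n (A : 'M[R]_(m, n)) : opnorm (- A) = opnorm A.
Proof.
rewrite /opnorm; congr sup; apply/seteqP; split=> _ [u u1 <-];
  by exists u => //; rewrite mulNmx enormN.
Qed.

End operator_norm.

(** * Standard Gaussian vectors on a probability space *)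

(** Tuples carry a product sigma-algebra, column vectors a linear structure; this
    map is the passage from the former to the latter. *)
Definition col_of_tuple (R : realType) p (w : p.-tuple R) : 'cV[R]_p :=
  \col_i tnth w i.

Section standard_gaussian.
Local Open Scope ereal_scope.
Context d (Omega : measurableType d) (R : realType) (P : probability Omega R)
  (p : nat) (W : 'I_p -> {RV P >-> R}).

Let random_tuple x := [tuple W i x | i < p].

Let measurable_random_tuple : measurable_fun setT random_tuple.
Proof.
apply/measurable_fun_tnthP => i.
rewrite (_ : _ \o _ = W i); first exact: measurable_funPT.
by apply/funext => x /=; rewrite tnth_mktuple.
Qed.

Let random_tuple_mfun : {mfun Omega >-> p.-tuple R} :=
  HB.pack random_tuple (isMeasurableFun.Build _ _ _ _ _ measurable_random_tuple).

Let random_colE x : random_col W x = col_of_tuple (random_tuple x).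
Proof. by apply/matrixP => i j; rewrite !mxE tnth_mktuple. Qed.

Lemma measurable_random_col (F : 'cV[R]_p -> R) :
  measurable_fun setT (F \o @col_of_tuple R p) ->
  measurable_fun setT (fun x => F (random_col W x)).
Proof.
move=> mF; under eq_fun do rewrite random_colE.
exact: (measurableT_comp mF measurable_random_tuple).
Qed.

Hypothesis gaussW : standard_gaussian W.

Let law_tuple (mu : probability (p.-tuple R) R) :
  (forall B, (forall i, measurable (B i)) ->
     mu (rectangle B) = \prod_(i < p) normal_prob 0 1 (B i)) ->
  forall A, measurable A -> distribution P random_tuple_mfun A = mu A.
Proof.
case: gaussW => indep normalW muB; apply: rectangle_measure_unique => B mB.
rewrite muB// -(eq_bigr _ (fun i _ => normalW i (B i) (mB i))) -indep//.
rewrite /distribution/pushforward; congr (P _).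
apply/seteqP; split => x /=.
  by move=> H i _; have := H i; rewrite tnth_mktuple.
by move=> H i; rewrite tnth_mktuple; exact: H.
Qed.

Lemma standard_gaussian_tau (F G : 'cV[R]_p -> R) :
  measurable_fun setT (F \o @col_of_tuple R p) ->
  measurable_fun setT (G \o @col_of_tuple R p) ->
  (forall u v, F u + G v <= enorm (u - v) ^+ 2 / 4)%R ->
  \int[P]_x (expR (F (random_col W x)))%:E *
  \int[P]_x (expR (G (random_col W x)))%:E <= 1.
Proof.
move=> mF mG FG.
have [mu [/law_tuple lawE tau_mu _]] := @exists_gaussian_vector R p.
have transfer (H : 'cV[R]_p -> R) : measurable_fun setT (H \o @col_of_tuple R p) ->
    \int[P]_x (expR (H (random_col W x)))%:E =
    \int[mu]_w (expR (H (col_of_tuple w)))%:E.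
  move=> mH; under eq_integral do rewrite random_colE.
  rewrite (@eq_measure_integral _ _ _ _ (distribution P random_tuple_mfun)); last first.
    by move=> A mA _; exact/esym/lawE.
  rewrite ge0_integral_distribution//.
  by apply/measurable_EFinP; exact: measurableT_comp mH.
rewrite !transfer//; apply: tau_mu.
- by apply/measurable_EFinP; exact: measurableT_comp mF.
- by apply/measurable_EFinP; exact: measurableT_comp mG.
- by move=> w; rewrite lee_fin expR_ge0.
- by move=> w; rewrite lee_fin expR_ge0.
- move=> u v; rewrite -EFinM -expRD lee_fin ler_expR.
  apply: (le_trans (FG _ _)); rewrite sqr_enorm mulr_suml.
  by apply: ler_sum => i _; rewrite !mxE.
Qed.

Lemma integral_expR_sqr_enorm :
  \int[P]_x (expR (enorm (random_col W x) ^+ 2 / 4))%:E = (Num.sqrt 2 ^+ p)%:E.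
Proof.
have [mu [/law_tuple lawE _ <-]] := @exists_gaussian_vector R p.
have mexp : measurable_fun setT
    (fun w : p.-tuple R => (expR (\sum_(i < p) tnth w i ^+ 2 / 4))%:E).
  apply/measurable_EFinP; apply: measurableT_comp => //.
  exact: measurable_sum_sqr.
rewrite (@eq_measure_integral _ _ _ _ (distribution P random_tuple_mfun)); last first.
  by move=> A mA _; exact/esym/lawE.
rewrite ge0_integral_distribution//.
apply: eq_integral => x _ /=; congr (expR _)%:E.
rewrite sqr_enorm mulr_suml; apply: eq_bigr => i _.
by rewrite mxE tnth_mktuple.
Qed.

End standard_gaussian.

(** * Quadratic forms and features: deterministic bounds *)

Section quadratic_form.
Context {R : realType}.

Definition quadratic_form n (A : 'M[R]_n) (u : 'cV[R]_n) : R :=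
  (u^T *m A *m u) 0 0.

Lemma quadratic_formE n (A : 'M[R]_n) (u : 'cV[R]_n) :
  quadratic_form A u = \sum_(i < n) \sum_(j < n) A i j * (u i 0 * u j 0).
Proof.
rewrite /quadratic_form -mulmxA dotE; apply: eq_bigr => i _.
rewrite mxE mulr_sumr; apply: eq_bigr => j _.
by rewrite mulrCA.
Qed.

Lemma quadratic_formN n (A : 'M[R]_n) (u : 'cV[R]_n) :
  quadratic_form (- A) u = - quadratic_form A u.
Proof. by rewrite /quadratic_form mulmxN mulNmx mxE. Qed.

Section contraction.
Variables (n : nat) (A : 'M[R]_n).
Hypothesis A1 : forall u : 'cV[R]_n, enorm (A *m u) <= enorm u.

Let bilinear_le (u v : 'cV[R]_n) : (u^T *m A *m v) 0 0 <= enorm u * enorm v.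
Proof.
rewrite -mulmxA (le_trans (ler_norm _))// (le_trans (cauchy_schwarz _ _))//.
by rewrite ler_wpM2l ?enorm_ge0.
Qed.

(** u.Au - v.Av = (u - v).Au + v.A(u - v), and |v| <= |u| + |u - v|. *)
Lemma quadratic_formB_le (u v : 'cV[R]_n) :
  quadratic_form A u - quadratic_form A v <=
  2 * enorm u * enorm (u - v) + enorm (u - v) ^+ 2.
Proof.
have -> : quadratic_form A u - quadratic_form A v =
    ((u - v)^T *m A *m u) 0 0 + (v^T *m A *m (u - v)) 0 0.
  have -> : (u - v)^T = u^T - v^T by apply/matrixP => i j; rewrite !mxE.
  have subE (M N : 'M[R]_1) : (M - N) 0 0 = M 0 0 - N 0 0 by rewrite !mxE.
  rewrite !mulmxBl mulmxBr !subE /quadratic_form; ring.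
apply: (le_trans (lerD (bilinear_le _ _) (bilinear_le _ _))).
have : enorm v <= enorm u + enorm (u - v).
  rewrite -{1}(subKr u v) -[enorm (u - v)]enormN; exact: enormD.
move=> /(ler_wpM2r (enorm_ge0 (u - v))); lra.
Qed.

End contraction.
End quadratic_form.

Section feature_bounds.
Context {R : realType}.
Variables (p T : nat) (phi sigma : R -> R) (lphi lsigma K : R).
Variable X : 'M[R]_(p, T).
Hypotheses (lphi0 : 0 < lphi) (lsigma0 : 0 < lsigma) (K0 : 0 <= K).
Hypothesis phi_lip : lphi.-lipschitz phi.
Hypothesis sigma_lip : lsigma.-lipschitz sigma.
Hypothesis XK : opnorm X <= K.

Let lip (f : R -> R) l : l.-lipschitz f -> forall x y, `|f x - f y| <= l * `|x - y|.
Proof. by move=> fl x y; exact: (fl (x, y)). Qed.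

Let XTK (v : 'cV[R]_p) : enorm (X^T *m v) <= K * enorm v.
Proof.
by rewrite (le_trans (opnorm_trmx_le _ _))// ler_wpM2r ?enorm_ge0.
Qed.

Let featureE (u : 'cV[R]_p) :
  feature phi sigma X u = map_mx sigma (X^T *m map_mx phi u).
Proof. by rewrite /feature map_trmx trmx_mul trmxK. Qed.

Lemma feature_lipschitz (u v : 'cV[R]_p) :
  enorm (feature phi sigma X u - feature phi sigma X v) <=
  lphi * lsigma * K * enorm (u - v).
Proof.
rewrite !featureE (le_trans (enorm_lipschitz _ _ (ltW lsigma0) (lip sigma_lip)))//.
rewrite -mulmxBr [lphi * _]mulrC -!mulrA ler_wpM2l ?(ltW lsigma0)//.
rewrite mulrCA (le_trans (XTK _))// ler_wpM2l//.
exact: (enorm_lipschitz _ _ (ltW lphi0) (lip phi_lip)).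
Qed.

(** The term phi(0) contributes sqrt p |phi(0)| to |phi(u)|: dividing by lphi
    puts it on the scale of |u|. *)
Lemma feature_growth (u : 'cV[R]_p) :
  enorm (feature phi sigma X u) <= Num.sqrt T%:R * `|sigma 0| +
    lphi * lsigma * K * (`|phi 0| / lphi * Num.sqrt p%:R + enorm u).
Proof.
have grow n (f : R -> R) l (v : 'cV[R]_n) : 0 < l -> l.-lipschitz f ->
    enorm (map_mx f v) <= Num.sqrt n%:R * `|f 0| + l * enorm v.
  move=> l0 fl; rewrite -[map_mx f v](subrK (map_mx f 0)) addrC.
  apply: (le_trans (enormD _ _)).
  have -> : map_mx f (0 : 'cV[R]_n) = const_mx (f 0).
    by apply/matrixP => i j; rewrite !mxE.
  rewrite enorm_const lerD2l.
  have -> : const_mx (f 0) = map_mx f (0 : 'cV[R]_n).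
    by apply/matrixP => i j; rewrite !mxE.
  rewrite -{2}(subr0 v).
  exact: (enorm_lipschitz _ _ (ltW l0) (lip fl)).
rewrite featureE (le_trans (grow _ _ _ _ lsigma0 sigma_lip))// lerD2l.
have -> : lphi * lsigma * K * (`|phi 0| / lphi * Num.sqrt p%:R + enorm u) =
    lsigma * (K * (Num.sqrt p%:R * `|phi 0| + lphi * enorm u)).
  by field; rewrite gt_eqF.
rewrite ler_wpM2l ?(ltW lsigma0)// (le_trans (XTK _))// ler_wpM2l//.
exact: grow.
Qed.

Let lipschitz_measurable (f : R -> R) l : 0 < l -> l.-lipschitz f ->
  measurable_fun setT f.
Proof.
move=> l0 /lip fl; apply: continuous_measurable_fun => x.
apply/cvgrPdist_le => e e0; near=> y.
apply: (le_trans (fl _ _)); rewrite mulrC -ler_pdivlMr//.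
by near: y; apply: cvgr_dist_le; [exact: cvg_id|rewrite divr_gt0].
Unshelve. all: by end_near. Qed.

Lemma measurable_feature (i : 'I_T) :
  measurable_fun setT
    (fun w => feature phi sigma X (@col_of_tuple R p w) i 0).
Proof.
have E w : feature phi sigma X (col_of_tuple w) i 0 =
    sigma (\sum_(k < p) X k i * phi (tnth w k)).
  by rewrite featureE mxE [X in sigma X]mxE; congr sigma;
    apply: eq_bigr => k _; rewrite !mxE.
under eq_fun do rewrite E.
apply: (measurableT_comp (lipschitz_measurable lsigma0 sigma_lip)).
apply: measurable_sum => k; apply: measurable_funM => //.
apply: (measurableT_comp (lipschitz_measurable lphi0 phi_lip)).
exact: measurable_tnth.
Qed.

Lemma measurable_quadratic_form_feature (A : 'M[R]_T) :
  measurable_fun setT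
    (fun w => quadratic_form A (feature phi sigma X (@col_of_tuple R p w))).
Proof.
under eq_fun do rewrite quadratic_formE.
apply: measurable_sum => i; apply: measurable_sum => j.
by apply: measurable_funM => //; apply: measurable_funM; exact: measurable_feature.
Qed.

End feature_bounds.

(** * Exponential tail bounds *)

Lemma chernoff_bound d (Omega : measurableType d) (R : realType)
    (P : probability Omega R) (f : Omega -> R) (a : R) :
  measurable_fun setT f ->
  (P [set x | (a <= f x)%R] <=
   (expR (- a))%:E * \int[P]_x (expR (f x))%:E)%E.
Proof.
move=> mf.
have mA := measurable_ge_set a mf.
have mexp : measurable_fun setT (fun x => (expR (f x))%:E).
  by apply/measurable_EFinP; exact: measurableT_comp mf.
rewrite -[X in P X]setIT -integral_indic// -ge0_integralZl ?lee_fin ?expR_ge0//.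
apply: ge0_le_integral => //.
- by apply/measurable_EFinP; exact: measurable_indic.
- exact: emeasurable_funM.
move=> x _; rewrite -EFinM -expRD lee_fin indicE.
case: (boolP (_ \in _)) => [|_]; last exact: expR_ge0.
by move=> /set_mem/= ax; rewrite -[leLHS]expR0 ler_expR addrC subr_ge0.
Qed.

Section gaussian_concentration.
Context d (Omega : measurableType d) (R : realType) (P : probability Omega R)
  (p : nat) (W : 'I_p -> {RV P >-> R}).
Hypothesis gaussW : standard_gaussian W.

Lemma measurable_enorm :
  measurable_fun setT (@enorm R p \o @col_of_tuple R p).
Proof.
have msum : measurable_fun setT
    (fun w : p.-tuple R => \sum_(i < p) (col_of_tuple w) i 0 ^+ 2).
  apply: measurable_sum => i; apply: measurable_funX.
  under eq_fun do rewrite mxE.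
  exact: measurable_tnth.
have msqrt : measurable_fun setT (@Num.sqrt R).
  by apply: continuous_measurable_fun; exact: sqrt_continuous.
exact: (measurableT_comp msqrt msum).
Qed.

Lemma integrable_gaussian (F : 'cV[R]_p -> R) (c : R) :
  measurable_fun setT (F \o @col_of_tuple R p) ->
  (forall u, `|F u| <= c * expR (enorm u ^+ 2 / 4)) ->
  P.-integrable setT (fun x => (F (random_col W x))%:E).
Proof.
move=> mF Fc; have mFW := measurable_random_col W mF.
have c0 : 0 <= c.
  have := le_trans (normr_ge0 _) (Fc 0).
  by rewrite pmulr_lge0// expR_gt0.
apply/integrableP; split; first exact/measurable_EFinP.
have mexp : measurable_fun setT (fun x =>
    (expR (enorm (random_col W x) ^+ 2 / 4))%:E).
  apply/measurable_EFinP; apply: measurableT_comp => //.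
  apply: (@measurable_random_col _ _ _ _ _ _ (fun u => enorm u ^+ 2 / 4)).
  by apply: measurable_funM => //; apply: measurable_funX; exact: measurable_enorm.
apply: (@le_lt_trans _ _ (c%:E * (Num.sqrt 2 ^+ p)%:E)%E); last by rewrite ltry.
rewrite -(integral_expR_sqr_enorm gaussW) -ge0_integralZl ?lee_fin//.
apply: ge0_le_integral => //.
- by apply: measurableT_comp => //; exact/measurable_EFinP.
- exact: emeasurable_funM.
- by move=> x _ /=; rewrite lee_fin.
Qed.

(** The threshold 2 sqrt p absorbs E exp (|W|^2 / 4) = 2^(p/2), since
    (2 sqrt p + r)^2 / 4 >= p + r^2 / 4 and sqrt 2 <= exp 1. *)
Lemma enorm_gaussian_tail (r : R) : 0 <= r ->
  (P [set x | (2 * Num.sqrt p%:R + r <= enorm (random_col W x))%R] <=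
   (expR (- (r ^+ 2 / 4)))%:E)%E.
Proof.
move=> r0; pose a : R := p%:R + r ^+ 2 / 4.
pose f x := enorm (random_col W x) ^+ 2 / 4.
have mf : measurable_fun setT f.
  apply: (@measurable_random_col _ _ _ _ _ _ (fun u => enorm u ^+ 2 / 4)).
  by apply: measurable_funM => //; apply: measurable_funX; exact: measurable_enorm.
pose s : R := Num.sqrt p%:R.
have s0 : 0 <= s by exact: sqrtr_ge0.
have s2 : s ^+ 2 = p%:R by rewrite sqr_sqrtr.
have eventE : [set x | 2 * s + r <= enorm (random_col W x)] =
    [set x | (2 * s + r) ^+ 2 / 4 <= f x].
  apply: eq_set => x; rewrite /f ler_pM2r// ler_pXn2r//.
    by rewrite nnegrE addr_ge0// mulr_ge0.
  by rewrite nnegrE enorm_ge0.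
apply: (@le_trans _ _ (P [set x | a <= f x])).
  rewrite eventE; apply: le_measure; rewrite ?inE; try exact: measurable_ge_set.
  move=> x /=; apply: le_trans.
  by rewrite /a -s2; have := mulr_ge0 s0 r0; lra.
apply: (le_trans (chernoff_bound P a mf)).
rewrite integral_expR_sqr_enorm// -EFinM lee_fin /a opprD expRD.
rewrite mulrAC ler_piMl ?expR_ge0// expRN mulrC ler_pdivrMr ?expR_gt0// mul1r.
rewrite -[X in expR X]mulr1 expRM_natl lerXn2r ?nnegrE ?sqrtr_ge0 ?expR_ge0//.
apply: (@le_trans _ _ 2); last by apply: le_trans (expR_ge1Dx 1); lra.
by rewrite -(@ler_pXn2r _ 2)// ?nnegrE ?sqrtr_ge0// sqr_sqrtr//; lra.
Qed.

(** Integrate exp y >= 1 + y. The exponential need not be integrable, so the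
    comparison goes through the positive part of 1 + y. *)
Lemma expectation_expR_ge1 (F : Omega -> R) (m l : R) :
  P.-integrable setT (EFin \o F) -> (\int[P]_x (F x)%:E = m%:E)%E ->
  (1 <= \int[P]_x (expR (l * (F x - m)))%:E)%E.
Proof.
move=> intF Fm.
have mF : measurable_fun setT F by apply/measurable_EFinP; exact: measurable_int intF.
have intL : P.-integrable setT (fun x => ((l * (F x - m))%:E)%E).
  apply: (eq_integrable _ (fun x => l%:E * ((F x)%:E - m%:E))%E) => //.
  apply: integrableZl => //; apply: integrableB => //.
  exact: finite_measure_integrable_cst.
have L0 : (\int[P]_x (l * (F x - m))%:E = 0)%E.
  under eq_integral do rewrite EFinM EFinB.
  rewrite integralZl//; last first.
    apply: integrableB => //; exact: finite_measure_integrable_cst.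
  rewrite integralB//; last exact: finite_measure_integrable_cst.
  by rewrite Fm integral_cst//= probability_setT mule1 subee// mule0.
pose g x := (1 + l * (F x - m))%:E.
have intg : P.-integrable setT g.
  apply: (eq_integrable _ (cst 1%E \+ (fun x => (l * (F x - m))%:E))%E) => //.
  by apply: integrableD => //; exact: finite_measure_integrable_cst.
have -> : (1 = \int[P]_x g x)%E.
  under eq_integral do rewrite /g EFinD.
  rewrite integralD//; last exact: finite_measure_integrable_cst.
  by rewrite L0 adde0 integral_cst//= probability_setT mule1.
have mexp : measurable_fun setT (fun x => (expR (l * (F x - m)))%:E).
  apply/measurable_EFinP; apply: measurableT_comp => //.
  by apply: measurable_funM => //; exact: measurable_funB.
apply: (@le_trans _ _ (\int[P]_x (g^\+)%E x)%E).
  apply: le_integral => //; first exact: integrable_funepos.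
  by move=> x _; rewrite funeposE le_max lexx.
apply: ge0_le_integral => //.
- exact/measurable_funepos/(measurable_int P).
- move=> x _; rewrite funeposE ge_max !lee_fin expR_ge0 andbT.
  exact: expR_ge1Dx.
Qed.

End gaussian_concentration.

Section quadratic_growth.
Context d (Omega : measurableType d) (R : realType) (P : probability Omega R)
  (p : nat) (W : 'I_p -> {RV P >-> R}).
Hypothesis gaussW : standard_gaussian W.
Variables (F S : 'cV[R]_p -> R) (L b m : R).
Hypotheses (mF : measurable_fun setT (F \o @col_of_tuple R p))
  (mS : measurable_fun setT (S \o @col_of_tuple R p)).
Hypotheses (L0 : 0 < L) (b0 : 0 < b) (S0 : forall u, 0 <= S u).
Hypothesis FS : forall u v, F u - F v <=
  2 * S u * (L * enorm (u - v)) + (L * enorm (u - v)) ^+ 2.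
Hypothesis Sb : forall u, S u <= b + L * (enorm u - 2 * Num.sqrt p%:R).
Hypothesis intF : P.-integrable setT (fun x => (F (random_col W x))%:E).
Hypothesis Fm : (\int[P]_x (F (random_col W x))%:E = m%:E)%E.

(** The penalty 8 l^2 L^2 S^2 is what property (tau) costs for F: with
    z = |u - v|, the oscillation l (2 S L z + L^2 z^2) is at most
    z^2 / 4 + 8 l^2 L^2 S^2 when 8 l L^2 <= 1. *)
Lemma penalized_exp_moment (l : R) : 0 < l -> 8 * l * L ^+ 2 <= 1 ->
  (\int[P]_x (expR (l * (F (random_col W x) - m) -
     8 * l ^+ 2 * L ^+ 2 * S (random_col W x) ^+ 2))%:E <= 1)%E.
Proof.
move=> l0 lL.
have := @standard_gaussian_tau _ _ _ _ _ _ gaussW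
  (fun u => l * (F u - m) - 8 * l ^+ 2 * L ^+ 2 * S u ^+ 2)
  (fun v => (- l) * (F v - m)).
have /(_ (- l)) := expectation_expR_ge1 _ intF Fm.
set I := (\int[P]_x _)%E; set J := (\int[P]_x _)%E => I1 IJ.
apply: le_trans (IJ _ _ _); last first.
- move=> u v; set z := enorm (u - v).
  have /(ler_wpM2l (ltW l0)) := FS u v; rewrite -/z => FSl.
  have z0 : 0 <= z by exact: enorm_ge0.
  have lz : 8 * l * L ^+ 2 * z ^+ 2 <= z ^+ 2 by rewrite ler_piMl ?sqr_ge0.
  have := sqr_ge0 (z - 8 * l * L * S u); lra.
- by apply: measurable_funM => //; exact: measurable_funB.
- apply: measurable_funB; apply: measurable_funM => //.
    exact: measurable_funB.
  exact: measurable_funX.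
rewrite -[leLHS]mule1; apply: lee_wpmul2l => //.
by apply: integral_ge0 => x _; rewrite lee_fin expR_ge0.
Qed.

(** The exponent l is chosen so that l h = M / 64, M being the minimum in the
    statement. Then S <= b + sqrt h keeps the penalty below l h / 2, and the
    event where S is larger is one where |W| is large. *)
Lemma quadratic_growth_tail (h : R) : 0 < h ->
  (P [set x | (h < F (random_col W x) - m)%R] <=
   (2 * expR (- (Num.min (h ^+ 2 / (L ^+ 2 * b ^+ 2)) (h / L ^+ 2) / 128)))%:E)%E.
Proof.
move=> h0; set M := Num.min _ _.
have L2 : 0 < L ^+ 2 by rewrite exprn_gt0.
have b2 : 0 < b ^+ 2 by rewrite exprn_gt0.
have M0 : 0 < M by rewrite lt_min !divr_gt0// ?exprn_gt0// mulr_gt0.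
have Mb : M * (L ^+ 2 * b ^+ 2) <= h ^+ 2.
  by rewrite -ler_pdivlMr ?mulr_gt0// ge_min lexx.
have ML : M * L ^+ 2 <= h by rewrite -ler_pdivlMr// ge_min lexx orbT.
pose l := M / (64 * h).
have l0 : 0 < l by rewrite divr_gt0// mulr_gt0.
have lh : l * h = M / 64 by rewrite /l; field; rewrite gt_eqF.
have lL : 64 * (l * L ^+ 2) <= 1.
  have -> : 64 * (l * L ^+ 2) = M * L ^+ 2 / h by rewrite /l; field; rewrite gt_eqF.
  by rewrite ler_pdivrMr// mul1r.
have lb : 64 * (l * L ^+ 2 * b ^+ 2) <= h.
  have -> : 64 * (l * L ^+ 2 * b ^+ 2) = M * (L ^+ 2 * b ^+ 2) / h.
    by rewrite /l; field; rewrite gt_eqF.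
  by rewrite ler_pdivrMr// -expr2.
pose r := Num.sqrt h / L.
have r0 : 0 <= r by rewrite divr_ge0 ?sqrtr_ge0// ltW.
pose f x := l * (F (random_col W x) - m) -
  8 * l ^+ 2 * L ^+ 2 * S (random_col W x) ^+ 2.
have mFW := measurable_random_col W mF.
have mSW := measurable_random_col W mS.
have mf : measurable_fun setT f.
  apply: measurable_funB; apply: measurable_funM => //.
    exact: measurable_funB.
  exact: measurable_funX.
have mE : measurable_fun setT (fun x => enorm (random_col W x)).
  by apply: measurable_random_col; exact: measurable_enorm.
pose E1 := [set x | l * h / 2 <= f x].
pose E2 := [set x | 2 * Num.sqrt p%:R + r <= enorm (random_col W x)].
have sub : [set x | h < F (random_col W x) - m] `<=` E1 `|` E2.
  move=> x /= hF; have [E2x|E2x] := leP (2 * Num.sqrt p%:R + r) (enorm (random_col W x)).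
    by right.
  left; rewrite /E1 /f /=.
  set s := S _; have s0 : 0 <= s := S0 _.
  have sh : s <= b + Num.sqrt h.
    apply: (le_trans (Sb _)); rewrite lerD2l mulrC -ler_pdivlMr// -/r; lra.
  have s2 : s ^+ 2 <= 2 * b ^+ 2 + 2 * h.
    apply: (@le_trans _ _ ((b + Num.sqrt h) ^+ 2)).
      by rewrite ler_pXn2r// nnegrE addr_ge0 ?sqrtr_ge0// ltW.
    have hh : Num.sqrt h ^+ 2 = h by rewrite sqr_sqrtr// ltW.
    by have := sqr_ge0 (b - Num.sqrt h); lra.
  have lF : l * h <= l * (F (random_col W x) - m) by rewrite ler_wpM2l// ltW.
  have c0 : 0 <= 8 * l * (l * L ^+ 2).
    by have := mulr_ge0 (ltW l0) (mulr_ge0 (ltW l0) (sqr_ge0 L)); lra.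
  have := ler_wpM2l c0 s2.
  have := ler_wpM2l (ltW l0) lb.
  have lh0 : 0 <= l * h by rewrite mulr_ge0// ltW.
  have := ler_wpM2l lh0 lL.
  lra.
have mE1 : measurable E1 by exact: measurable_ge_set.
have mE2 : measurable E2 by exact: measurable_ge_set.
apply: (@le_trans _ _ (P (E1 `|` E2))).
  apply: le_measure; rewrite ?inE//; [|exact: measurableU].
  by apply: measurable_gt_set; exact: measurable_funB.
apply: (le_trans (measureU2 _ mE1 mE2)).
rewrite mulr_natl mulr2n EFinD; apply: leeD.
- apply: (le_trans (chernoff_bound P _ mf)).
  apply: (@le_trans _ _ ((expR (- (l * h / 2)))%:E * 1)%E).
    apply: lee_wpmul2l; first by rewrite lee_fin expR_ge0.
    by apply: penalized_exp_moment => //; lra.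
  by rewrite mule1 lee_fin ler_expR lh; lra.
- apply: (le_trans (enorm_gaussian_tail gaussW r0)).
  rewrite lee_fin ler_expR lerN2 /r expr_div_n sqr_sqrtr ?(ltW h0)//.
  have : M <= h / L ^+ 2 by rewrite ge_min lexx orbT.
  by have : 0 <= h / L ^+ 2; [rewrite divr_ge0 ?ltW|lra].
Qed.

End quadratic_growth.

(** * Deviation of the quadratic form of the features *)

Section feature_deviation.
Context d (Omega : measurableType d) (R : realType) (P : probability Omega R).
Variables (p T : nat) (W : 'I_p -> {RV P >-> R}).
Variables (phi sigma : R -> R) (lphi lsigma K : R) (X : 'M[R]_(p, T)).
Hypothesis gaussW : standard_gaussian W.
Hypotheses (lphi0 : 0 < lphi) (lsigma0 : 0 < lsigma) (K0 : 0 < K).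
Hypothesis phi_lip : lphi.-lipschitz phi.
Hypothesis sigma_lip : lsigma.-lipschitz sigma.
Hypothesis XK : opnorm X <= K.

Let s := feature phi sigma X.
Let L := lphi * lsigma * K.

Let L0 : 0 < L. Proof. by rewrite !mulr_gt0. Qed.

Let ms (i : 'I_T) : measurable_fun setT (fun w => s (@col_of_tuple R p w) i 0).
Proof. exact: (measurable_feature X lphi0 lsigma0 phi_lip sigma_lip). Qed.

Let s_growth : exists c, forall u, enorm (s u) ^+ 2 <= c * expR (enorm u ^+ 2 / 4).
Proof.
pose a := Num.sqrt T%:R * `|sigma 0| + L * (`|phi 0| / lphi * Num.sqrt p%:R).
exists (2 * a ^+ 2 + 8 * L ^+ 2) => u.
have su : enorm (s u) <= a + L * enorm u.
  rewrite /a -addrA -mulrDr.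
  exact: (feature_growth lphi0 lsigma0 (ltW K0) phi_lip sigma_lip XK).
have a0 : 0 <= a.
  by rewrite addr_ge0 ?mulr_ge0 ?sqrtr_ge0 ?invr_ge0 ?(ltW lphi0) ?(ltW lsigma0) ?(ltW K0).
have su2 : enorm (s u) ^+ 2 <= 2 * a ^+ 2 + 8 * L ^+ 2 * (enorm u ^+ 2 / 4).
  apply: (@le_trans _ _ ((a + L * enorm u) ^+ 2)).
    by rewrite ler_pXn2r// nnegrE ?enorm_ge0// addr_ge0// mulr_ge0 ?enorm_ge0// ltW.
  by have := sqr_ge0 (a - L * enorm u); lra.
apply: (le_trans su2); rewrite [leRHS]mulrDl lerD//.
  rewrite ler_peMr ?mulr_ge0 ?sqr_ge0//.
  by rewrite -[leLHS]expR0 ler_expR divr_ge0 ?sqr_ge0.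
apply: ler_wpM2l; first by rewrite mulr_ge0 ?sqr_ge0.
by apply: le_trans (expR_ge1Dx _); rewrite lerDr.
Qed.

Let integrable_entries i j :
  P.-integrable setT (fun x => (s (random_col W x) i 0 * s (random_col W x) j 0)%:E).
Proof.
have [c sc] := s_growth.
apply: (integrable_gaussian gaussW (F := fun u => s u i 0 * s u j 0) (c := c)).
  by apply: measurable_funM; exact: ms.
move=> u; apply: le_trans (sc u).
have entry k : s u k 0 ^+ 2 <= enorm (s u) ^+ 2.
  rewrite sqr_enorm (bigD1 k)//= lerDl sumr_ge0// => l _; exact: sqr_ge0.
rewrite ler_norml; have := entry i; have := entry j.
have := sqr_ge0 (s u i 0 - s u j 0); have := sqr_ge0 (s u i 0 + s u j 0).
by move=> *; apply/andP; split; lra.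
Qed.

Let S x := s (random_col W x).

Lemma integrable_quadratic_form (A : 'M[R]_T) :
  P.-integrable setT (fun x => (quadratic_form A (S x))%:E).
Proof.
under eq_fun do rewrite quadratic_formE -sumEFin.
apply: integrable_sum => // i _.
under eq_fun do rewrite -sumEFin.
apply: integrable_sum => // j _.
under eq_fun do rewrite EFinM.
by apply: integrableZl => //; exact: integrable_entries.
Qed.

Lemma expectation_quadratic_form (A : 'M[R]_T) :
  (\int[P]_x (quadratic_form A (S x))%:E = (\tr (second_moment P S *m A))%:E)%E.
Proof.
have ssE x i j : (S x *m (S x)^T) i j = S x i 0 * S x j 0.
  by rewrite mxE big_ord1 [(S x)^T _ _]mxE.
have EE i j : (\int[P]_x (S x i 0 * S x j 0)%:E = (second_moment P S i j)%:E)%E.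
  have -> : second_moment P S i j = fine (\int[P]_x (S x i 0 * S x j 0)%:E).
    rewrite mxE unlock; congr fine.
    by apply: eq_integral => x _; rewrite ssE.
  rewrite fineK//.
  by apply: integrable_fin_num => //; exact: integrable_entries.
under eq_integral do rewrite quadratic_formE -sumEFin.
rewrite integral_sum//; last first.
  move=> i; under eq_fun do rewrite -sumEFin.
  apply: integrable_sum => // j _; under eq_fun do rewrite EFinM.
  by apply: integrableZl => //; exact: integrable_entries.
rewrite /mxtrace -sumEFin.
under [RHS]eq_bigr do rewrite mxE -sumEFin.
rewrite exchange_big/=; apply: eq_bigr => i _.
under eq_integral do rewrite -sumEFin.
rewrite integral_sum//; last first.
  move=> j; under eq_fun do rewrite EFinM.
  by apply: integrableZl => //; exact: integrable_entries.
apply: eq_bigr => j _; under eq_integral do rewrite EFinM.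
rewrite integralZl// EFinM -EE muleC.
by congr (_ * _)%E; apply: eq_integral => x _; rewrite mulrC.
Qed.

Let q := `|phi 0| / lphi + 2.

Lemma feature_upper_tail (A : 'M[R]_T) (tau t : R) :
  (0 < T)%N -> opnorm A <= 1 -> 0 < tau -> 0 < t ->
  `|sigma 0| + L * Num.sqrt (p%:R / T%:R) <= tau ->
  (P [set x | (T%:R * t < quadratic_form A (S x) - \tr (second_moment P S *m A))%R] <=
   (2 * expR (- (((128 * q ^+ 2)^-1 * T%:R / L ^+ 2)
                 * Num.min (t ^+ 2 / tau ^+ 2) t)))%:E)%E.
Proof.
move=> T0 A1 tau0 t0 tau_ge.
have TR0 : 0 < T%:R :> R by rewrite ltr0n.
have sT0 : 0 < Num.sqrt (T%:R : R) by rewrite sqrtr_gt0.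
have sT2 : Num.sqrt (T%:R : R) ^+ 2 = T%:R by rewrite sqr_sqrtr// ltW.
have r0 : 0 <= `|phi 0| / lphi by rewrite divr_ge0// ltW.
have q0 : 0 < q by rewrite ltr_wpDl.
have A1' u : enorm (A *m u) <= enorm u.
  by rewrite (le_trans (le_opnorm _ _))// ler_piMl ?enorm_ge0.
pose b := q * (Num.sqrt T%:R * tau).
have b0 : 0 < b by rewrite !mulr_gt0.
have h0 : 0 < T%:R * t by rewrite mulr_gt0.
have mF : measurable_fun setT ((fun u => quadratic_form A (s u)) \o @col_of_tuple R p).
  exact: (measurable_quadratic_form_feature X lphi0 lsigma0 phi_lip sigma_lip A).
have mS : measurable_fun setT ((fun u => enorm (s u)) \o @col_of_tuple R p).
  have msqrt : measurable_fun setT (@Num.sqrt R).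
    by apply: continuous_measurable_fun; exact: sqrt_continuous.
  apply: (measurableT_comp msqrt).
  by apply: measurable_sum => i; apply: measurable_funX; exact: ms.
have FS u v : quadratic_form A (s u) - quadratic_form A (s v) <=
    2 * enorm (s u) * (L * enorm (u - v)) + (L * enorm (u - v)) ^+ 2.
  apply: (le_trans (quadratic_formB_le A1' _ _)).
  have suv : enorm (s u - s v) <= L * enorm (u - v).
    exact: (feature_lipschitz lphi0 lsigma0 (ltW K0) phi_lip sigma_lip XK).
  rewrite lerD//; first by rewrite ler_wpM2l// mulr_ge0 ?enorm_ge0.
  by rewrite ler_pXn2r// nnegrE ?enorm_ge0// mulr_ge0 ?enorm_ge0// ltW.
(* The summand 2 of q pays for the shift by 2 sqrt p. *)
have Sb u : enorm (s u) <= b + L * (enorm u - 2 * Num.sqrt p%:R).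
  apply: (le_trans (feature_growth lphi0 lsigma0 (ltW K0) phi_lip sigma_lip XK u)).
  have spT : Num.sqrt (T%:R : R) * Num.sqrt (p%:R / T%:R) = Num.sqrt p%:R.
    by rewrite -sqrtrM ?ler0n// mulrC divfK// gt_eqF.
  have b_ge : q * (Num.sqrt T%:R * `|sigma 0| + L * Num.sqrt p%:R) <= b.
    by rewrite ler_wpM2l ?(ltW q0)// -spT mulrCA -mulrDr ler_wpM2l// ltW.
  have : 0 <= (q - 1) * (Num.sqrt T%:R * `|sigma 0|).
    by rewrite !mulr_ge0 ?sqrtr_ge0// /q; lra.
  rewrite -/L; move: b_ge; rewrite /q; lra.
have := @quadratic_growth_tail _ _ _ _ _ _ gaussW _ _ L b _ mF mS L0 b0
  (fun u => enorm_ge0 _) FS Sb (integrable_quadratic_form A)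
  (expectation_quadratic_form A) _ h0.
move=> /le_trans; apply; rewrite lee_fin ler_pM2l// ler_expR lerN2.
have L2 : 0 < L ^+ 2 by rewrite exprn_gt0.
have q1 : 1 <= q ^+ 2 by rewrite expr_ge1 ?(ltW q0)// /q; lra.
have q2 : 0 < q ^+ 2 by rewrite exprn_gt0.
set k := _ / L ^+ 2; set M := Num.min (t ^+ 2 / _) t.
have k0 : 0 <= 128 * k.
  by rewrite ltW// mulr_gt0// divr_gt0// mulr_gt0// invr_gt0 mulr_gt0.
rewrite ler_pdivlMr// mulrC mulrA le_min; apply/andP; split.
  apply: (@le_trans _ _ (128 * k * (t ^+ 2 / tau ^+ 2))).
    by rewrite ler_wpM2l// ge_min lexx.
  rewrite /b exprMn [(q * _) ^+ 2]exprMn [(_ * tau) ^+ 2]exprMn sT2 /k.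
  rewrite le_eqVlt; apply/orP; left; apply/eqP; field.
  by rewrite ?gt_eqF.
apply: (@le_trans _ _ (128 * k * t)).
  by rewrite ler_wpM2l// ge_min lexx orbT.
have -> : 128 * k * t = (q ^+ 2)^-1 * (T%:R * t / L ^+ 2).
  by rewrite /k; field; rewrite ?gt_eqF.
rewrite ler_piMl ?invf_le1// divr_ge0 ?(ltW L2)//; exact: ltW.
Qed.

End feature_deviation.

Lemma measurable_deviation_event d (Omega : measurableType d) (R : realType)
    (P : probability Omega R) (p T : nat) (W : 'I_p -> {RV P >-> R})
    (phi sigma : R -> R) (lphi lsigma t : R) (A : 'M[R]_T) (X : 'M[R]_(p, T)) :
  0 < lphi -> 0 < lsigma -> lphi.-lipschitz phi -> lsigma.-lipschitz sigma ->
  measurable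
    (deviation_event P A (fun x => feature phi sigma X (random_col W x)) t).
Proof.
move=> lphi0 lsigma0 phi_lip sigma_lip; set S := fun x => _.
have mA : measurable_fun setT (fun x => quadratic_form A (S x)).
  apply: (measurable_random_col W (F := fun u => quadratic_form A
    (feature phi sigma X u))).
  exact: (measurable_quadratic_form_feature X lphi0 lsigma0 phi_lip sigma_lip A).
apply: measurable_gt_set.
apply: measurableT_comp => //; apply: measurable_funB => //.
exact: measurable_funM.
Qed.

Lemma feature_deviation d (Omega : measurableType d) (R : realType)
    (P : probability Omega R) (p T : nat) (W : 'I_p -> {RV P >-> R})
    (phi sigma : R -> R) (lphi lsigma K tau t : R)
    (A : 'M[R]_T) (X : 'M[R]_(p, T)) :
  standard_gaussian W -> 0 < lphi -> 0 < lsigma -> 0 < K ->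
  lphi.-lipschitz phi -> lsigma.-lipschitz sigma ->
  opnorm X <= K -> opnorm A <= 1 -> (0 < T)%N -> 0 < tau -> 0 < t ->
  `|sigma 0| + lphi * lsigma * K * Num.sqrt (p%:R / T%:R) <= tau ->
  (P (deviation_event P A (fun x => feature phi sigma X (random_col W x)) t) <=
   (4 * expR (- (((128 * (`|phi 0| / lphi + 2) ^+ 2)^-1 * T%:R
                  / (lphi * lsigma * K) ^+ 2)
                 * Num.min (t ^+ 2 / tau ^+ 2) t)))%:E)%E.
Proof.
move=> gaussW lphi0 lsigma0 K0 phi_lip sigma_lip XK A1 T0 tau0 t0 tau_ge.
set S := fun x => _; set e := expR _.
have TR0 : 0 < T%:R :> R by rewrite ltr0n.
pose E (B : 'M[R]_T) := [set x |
  T%:R * t < quadratic_form B (S x) - \tr (second_moment P S *m B)].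
have mE B : measurable (E B).
  have mB : measurable_fun setT (fun x => quadratic_form B (S x)).
    apply: (measurable_random_col W (F := fun u => quadratic_form B
      (feature phi sigma X u))).
    exact: (measurable_quadratic_form_feature X lphi0 lsigma0 phi_lip sigma_lip B).
  by apply: measurable_gt_set; exact: measurable_funB.
have tail B : opnorm B <= 1 -> (P (E B) <= (2 * e)%:E)%E.
  by move=> B1; exact: (feature_upper_tail gaussW lphi0 lsigma0 K0 phi_lip sigma_lip XK).
have eventE : deviation_event P A S t = E A `|` E (- A).
  have devE x : (t < `|T%:R^-1 * ((S x)^T *m A *m S x) 0 0 -
        T%:R^-1 * \tr (second_moment P S *m A)|) =
      (T%:R * t < `|quadratic_form A (S x) - \tr (second_moment P S *m A)|).
    by rewrite -mulrBr normrM ger0_norm ?invr_ge0 ?ler0n// ltr_pdivlMl.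
  have EN x : E (- A) x = (T%:R * t <
      - (quadratic_form A (S x) - \tr (second_moment P S *m A))) :> Prop.
    by rewrite /E /= quadratic_formN mulmxN raddfN/= opprK opprB addrC.
  apply/seteqP; split => x; rewrite /deviation_event /= devE EN ltr_normr.
    by move=> /orP[]; [left|right].
  by move=> h; apply/orP.
rewrite eventE; apply: (le_trans (measureU2 _ (mE _) (mE _))).
have -> : 4 * e = 2 * e + 2 * e by lra.
by rewrite EFinD; apply: leeD; apply: tail; rewrite ?opnormN.
Qed.

(** * Growth rate and conclusion *)

Section growth_rate.
Context {R : realType}.

Let limn_esup_lty (u : nat -> R) : (limn_esup (fun n => (u n)%:E) < +oo)%E ->
  exists N M, forall n, (N <= n)%N -> u n <= M.
Proof.
move=> /ereal_inf_lt[_ [V [N _ NV] <-]].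
have ub n : (N <= n)%N -> ((u n)%:E <= ereal_sup [set (u n)%:E | n in V])%E.
  by move=> Nn; apply: ereal_sup_ubound; exists n => //; exact: NV.
case: (ereal_sup _) ub => [M||]//= ub _.
- by exists N, M => n /ub; rewrite lee_fin.
- by exists N, 0 => n /ub; rewrite leeNy_eq.
Qed.

Let limn_einf_gt0 (u : nat -> R) : (0 < limn_einf (fun n => (u n)%:E))%E ->
  exists N a, 0 < a /\ forall n, (N <= n)%N -> a <= u n.
Proof.
rewrite /limn_einf oppe_gt0 => /ereal_inf_lt[_ [V [N _ NV] <-]].
set sup := ereal_sup _.
have ub n : (N <= n)%N -> (- (u n)%:E <= sup)%E.
  by move=> Nn; apply: ereal_sup_ubound; exists n => //; exact: NV.
case: sup ub => [M||]//= ub M0.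
- exists N, (- M); split; first by rewrite oppr_gt0 -lte_fin.
  by move=> n /ub; rewrite lee_fin lerNl.
- by exists N, 1; split => // n /ub; rewrite leeNy_eq.
Qed.

Let bounded_of_eventually (u : nat -> R) (N : nat) (M : R) :
  (forall n, (N <= n)%N -> u n <= M) -> exists2 B, 0 < B & forall n, u n <= B.
Proof.
move=> uM; pose B := 1 + `|M| + \sum_(i < N) `|u i|.
have S0 : 0 <= \sum_(i < N) `|u i| by exact: sumr_ge0.
exists B => [|n]; first by rewrite /B; have := normr_ge0 M; lra.
have [Nn|nN] := leqP N n.
  by have := uM _ Nn; have := ler_norm M; rewrite /B; lra.
have : `|u n| <= \sum_(i < N) `|u i|.
  by rewrite (bigD1 (Ordinal nN))//= lerDl sumr_ge0.
by have := ler_norm (u n); have := normr_ge0 M; rewrite /B; lra.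
Qed.

(** For large n, T is at least a multiple of n, and p / T = (p / n) (n / T).
    The remaining indices are finite in number and only enlarge the bound; by
    the convention x / 0 = 0 they need no case distinction on T. *)
Lemma growth_rate_bounds (p T : nat -> nat) (X : forall n, 'M[R]_(p n, T n)) :
  growth_rate X -> exists B : R, 0 < B /\ forall n,
    [/\ n%:R / (T n)%:R <= B, (p n)%:R / (T n)%:R <= B & opnorm (X n) <= B].
Proof.
case=> /limn_einf_gt0[N1 [a [a0 aP]]] _ /limn_esup_lty[N2 [b bP]] /limn_esup_lty[N3 [K KP]].
have ev n : (maxn 1 (maxn N1 N2) <= n)%N ->
    n%:R / (T n)%:R <= a^-1 /\ (p n)%:R / (T n)%:R <= b / a.
  rewrite !geq_max => /and3P[n0 n1 n2].
  have nR : 0 < n%:R :> R by rewrite ltr0n.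
  have := aP _ n1; rewrite le_min => /andP[_ aT].
  have TR : 0 < (T n)%:R :> R.
    have := lt_le_trans a0 aT; by rewrite pmulr_lgt0// invr_gt0.
  have := bP _ n2; rewrite ge_max => /andP[pb _].
  have nT : n%:R / (T n)%:R <= a^-1.
    by rewrite -[leLHS]invrK invf_div lef_pV2 ?posrE// divr_gt0.
  split => //.
  have -> : (p n)%:R / (T n)%:R = ((p n)%:R / n%:R) * (n%:R / (T n)%:R) :> R.
    by field; rewrite !gt_eqF.
  by apply: ler_pM => //; rewrite divr_ge0// ler0n.
have [B1 B10 B1P] := bounded_of_eventually (fun n nN => (ev n nN).1).
have [B2 B20 B2P] := bounded_of_eventually (fun n nN => (ev n nN).2).
have [B3 B30 B3P] := bounded_of_eventually KP.
exists (B1 + B2 + B3); split; first by rewrite !addr_gt0.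
by move=> n; have := B1P n; have := B2P n; have := B3P n; split; lra.
Qed.

End growth_rate.

(* In the first part C is absolute and c is a fixed function of the ratio
   |phi(0)| / lphi alone; no constant independent of that ratio exists. *)
Theorem lemma1 (R : realType) :
  (exists (C : R) (c : R -> R), 0 < C /\ (forall r : R, 0 <= r -> 0 < c r) /\
    forall (lphi lsigma : R) (phi sigma : R -> R) (p T : nat)
           (A : 'M[R]_T) (X : 'M[R]_(p, T))
           (d : measure_display) (Omega : measurableType d)
           (P : probability Omega R) (W : 'I_p -> {RV P >-> R}) (t : R),
      0 < lphi -> 0 < lsigma ->
      lphi.-lipschitz phi -> lsigma.-lipschitz sigma ->
      opnorm A <= 1 ->
      standard_gaussian W ->
      0 < t ->
      let s := fun x => feature phi sigma X (random_col W x) in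
      let t0 := `|sigma 0|
                + lphi * lsigma * opnorm X * Num.sqrt (p%:R / T%:R) in
      (P (deviation_event P A s t)
       <= (C * expR (- (c (`|phi 0| / lphi) * T%:R
                        / (opnorm X ^+ 2 * lphi ^+ 2 * lsigma ^+ 2))
                     * Num.min (t ^+ 2 / t0 ^+ 2) t))%:E)%E)
  /\
  (forall (lphi lsigma : R) (phi sigma : R -> R) (p T : nat -> nat)
          (X : forall n, 'M[R]_(p n, T n)),
      0 < lphi -> 0 < lsigma ->
      lphi.-lipschitz phi -> lsigma.-lipschitz sigma ->
      growth_rate X ->
      exists C c : R, 0 < C /\ 0 < c /\
        forall (n : nat) (A : 'M[R]_(T n))
               (d : measure_display) (Omega : measurableType d)
               (P : probability Omega R) (W : 'I_(p n) -> {RV P >-> R}) (t : R),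
          opnorm A <= 1 ->
          standard_gaussian W ->
          0 < t ->
          let s := fun x => feature phi sigma (X n) (random_col W x) in
          (P (deviation_event P A s t)
           <= (C * expR (- (c * n%:R * Num.min t (t ^+ 2))))%:E)%E).
Proof.
split.
  exists 4, (fun r => (128 * (r + 2) ^+ 2)^-1); split => //; split.
    move=> r r0; rewrite invr_gt0 mulr_gt0// exprn_gt0//; lra.
  move=> lphi lsigma phi sigma p T A X d Omega P W t lphi0 lsigma0 phi_lip
    sigma_lip A1 gaussW t_gt0.
  set s := fun x : Omega => _; set t0 := `|sigma 0| + _; cbv zeta.
  rewrite mulNr.
  (* If X, T or t0 vanishes, division by zero makes the exponent zero, and the
     bound exceeds 1. *)
  have trivial_bound (x y : R) : x = 0 \/ y = 0 ->
      (P (deviation_event P A s t) <= (4 * expR (- (x * y)))%:E)%E.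
    have mdev : measurable (deviation_event P A s t).
      exact: (@measurable_deviation_event _ _ _ _ _ _ _ _ _ _ _ _ _ _
        lphi0 lsigma0 phi_lip sigma_lip).
    have P4 : (P (deviation_event P A s t) <= 4%:E)%E.
      by apply: (le_trans (probability_le1 _ mdev)); rewrite lee_fin; lra.
    by case=> ->; rewrite ?mul0r ?mulr0 oppr0 expR0 mulr1.
  have [K0|Kneq0] := eqVneq (opnorm X) 0.
    apply: trivial_bound; left.
    have -> : opnorm X ^+ 2 = 0 by rewrite K0 expr0n.
    by rewrite !mul0r invr0 mulr0.
  have K0 : 0 < opnorm X by rewrite lt_def Kneq0 opnorm_ge0.
  have [T0|Tgt0] := posnP T.
    have TR0 : T%:R = 0 :> R by rewrite T0.
    by apply: trivial_bound; left; rewrite TR0 mulr0 mul0r.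
  have t0_ge0 : 0 <= t0.
    by rewrite addr_ge0// !mulr_ge0 ?sqrtr_ge0 ?opnorm_ge0 ?(ltW lphi0) ?(ltW lsigma0).
  have [t0_eq0|t0_neq0] := eqVneq t0 0.
    apply: trivial_bound; right.
    have -> : t0 ^+ 2 = 0 by rewrite t0_eq0 expr0n.
    by rewrite invr0 mulr0 min_l// ltW.
  have t0_gt0 : 0 < t0 by rewrite lt_def t0_neq0.
  have -> : opnorm X ^+ 2 * lphi ^+ 2 * lsigma ^+ 2 =
      (lphi * lsigma * opnorm X) ^+ 2 by ring.
  exact: feature_deviation.
move=> lphi lsigma phi sigma p T X lphi0 lsigma0 phi_lip sigma_lip.
move=> /growth_rate_bounds[B [B0 BP]].
pose L := lphi * lsigma * B.
have L0 : 0 < L by rewrite !mulr_gt0.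
pose tau := `|sigma 0| + L * Num.sqrt B.
have tau0 : 0 < tau by rewrite ltr_wpDl// mulr_gt0// sqrtr_gt0.
pose k := (128 * (`|phi 0| / lphi + 2) ^+ 2)^-1.
have k0 : 0 < k.
  have : 0 <= `|phi 0| / lphi by rewrite divr_ge0// ltW.
  by move=> r0; rewrite invr_gt0 mulr_gt0// exprn_gt0//; lra.
(* mu converts the threshold t^2 / tau^2 into t^2. *)
pose mu := Num.min (tau ^+ 2)^-1 1.
have mu0 : 0 < mu by rewrite lt_min invr_gt0 exprn_gt0//=.
exists 4, (k / L ^+ 2 * mu / B); split => //; split.
  by rewrite divr_gt0// mulr_gt0// divr_gt0// exprn_gt0.
move=> n A d Omega P W t A1 gaussW t0.
set s := fun x : Omega => _; cbv zeta.
have [Tn0|Tn_gt0] := posnP (T n).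
  rewrite (_ : deviation_event _ _ _ _ = set0); last first.
    apply/seteqP; split => x //=; rewrite /deviation_event/=.
    have -> : (T n)%:R = 0 :> R by rewrite Tn0.
    by rewrite invr0 !mul0r subr0 normr0 ltNge (ltW t0).
  by rewrite measure0 lee_fin mulr_ge0 ?expR_ge0.
have TR : 0 < (T n)%:R :> R by rewrite ltr0n.
have [nT pT XB] := BP n.
have tau_ge : `|sigma 0| + L * Num.sqrt ((p n)%:R / (T n)%:R) <= tau.
  by rewrite lerD2l ler_wpM2l ?(ltW L0)// ler_wsqrtr.
apply: (le_trans (feature_deviation gaussW lphi0 lsigma0 B0 phi_lip sigma_lip
  XB A1 Tn_gt0 tau0 t0 tau_ge)).
rewrite lee_fin ler_pM2l// ler_expR lerN2 -/L -/k.
have kL0 : 0 <= k / L ^+ 2 by rewrite divr_ge0 ?sqr_ge0// ltW.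
have mint : 0 <= Num.min t (t ^+ 2) by rewrite le_min (ltW t0) sqr_ge0.
have mumin : mu * Num.min t (t ^+ 2) <= Num.min (t ^+ 2 / tau ^+ 2) t.
  rewrite le_min; apply/andP; split.
    rewrite mulrC; apply: ler_pM => //; [exact: ltW| |].
      by rewrite ge_min lexx orbT.
    by rewrite ge_min lexx.
  rewrite -[leRHS]mul1r; apply: ler_pM => //; [exact: ltW| |].
    by rewrite ge_min lexx orbT.
  by rewrite ge_min lexx.
rewrite ler_pdivrMr// in nT.
have nTB : n%:R / B <= (T n)%:R by rewrite ler_pdivrMr// mulrC.
have -> : k / L ^+ 2 * mu / B * n%:R * Num.min t (t ^+ 2) =
    (k / L ^+ 2) * ((n%:R / B) * (mu * Num.min t (t ^+ 2))) by ring.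
have -> : k * (T n)%:R / L ^+ 2 * Num.min (t ^+ 2 / tau ^+ 2) t =
    (k / L ^+ 2) * ((T n)%:R * Num.min (t ^+ 2 / tau ^+ 2) t) by ring.
apply: ler_wpM2l => //; apply: ler_pM => //.
- by rewrite divr_ge0// ltW.
- by rewrite mulr_ge0// ltW.
Qed.
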